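(* Every locally finite Borel graph $G$ satisfies $\mathrm{asdim}_{\mathbf{B}}(G)\le\mathrm{ar}(G)$, where $\mathrm{asdim}_{\mathbf{B}}(G)$ is the Borel asymptotic dimension of $G$ and $\mathrm{ar}(G)$ is its asymptotic growth rate.
   Context: Graphs are undirected and simple, with nonempty vertex set. A Borel graph is a graph $G$ whose vertex set is a standard Borel space and whose adjacency relation is a Borel subset of $V(G)^2$; $G$ is locally finite if every vertex has finitely many neighbors. $\mathrm{dist}_G$ is the graph metric ($\infty$ between different components), $B_G(u,r)$ the closed ball of radius $r$, $\gamma_G(r)=\sup_{u\in V(G)}|B_G(u,r)|\in[0,\infty]$, and $\mathrm{ar}(G)=\limsup_{r\to\infty}\frac{\log\gamma_G(r)}{\log(r+1)}\in[0,\infty]$. For a standard Borel space $X$, the set $[X]^{<\infty}$ of finite subsets of $X$ carries the standard Borel structure in which a set is Borel iff its preimage in $\bigsqcup_{k}X^k$ under $(x_0,\dots,x_{k-1})\mapsto\{x_0,\dots,x_{k-1}\}$ is Borel. A family $\mathcal{U}$ of subsets of $V(G)$ is uniformly bounded if $\sup_{U\in\mathcal{U}}\mathrm{diam}\,U<\infty$ (diameter in $\mathrm{dist}_G$), and $r$-disjoint if $\mathrm{dist}_G(U,U')>r$ for all distinct $U,U'\in\mathcal{U}$. For a locally finite Borel graph $G$, the Borel asymptotic dimension $\mathrm{asdim}_{\mathbf{B}}(G)$ is the least $n\in\mathbb{N}$ (if it exists) such that for every $r>0$ there are Borel families $\mathcal{U}_0,\dots,\mathcal{U}_n\subseteq[V(G)]^{<\infty}$,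 each uniformly bounded and $r$-disjoint, such that $\bigcup_{i=0}^n\mathcal{U}_i$ covers $V(G)$; if no such $n$ exists, $\mathrm{asdim}_{\mathbf{B}}(G)=\infty$. *)

(* Defs.v *)
From HB Require Import structures.
From mathcomp Require Import all_boot all_order all_algebra.
From mathcomp Require Import all_classical all_reals all_analysis.

Set Implicit Arguments.
Unset Strict Implicit.
Unset Printing Implicit Defensive.

Import Order.TTheory GRing.Theory Num.Theory.
Import numFieldNormedType.Exports.

Local Open Scope classical_set_scope.
Local Open Scope ring_scope.
Local Open Scope ereal_scope.

Definition polish_metric (R : realType) (M : metricType R) : Prop :=
  (forall F : set_system M, ProperFilter F -> cauchy F -> exists x : M, F --> x) /\
  (exists2 D : set M, countable D & dense D).

(* A measurable space is standard Borel when it is isomorphic to a Polish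
   space with its Borel sigma-algebra.  A [measurableType] is pointed, hence
   nonempty. *)
Definition standard_borel (R : realType) (d : measure_display)
    (V : measurableType d) : Prop :=
  exists (M : metricType R) (f : V -> M),
    [/\ polish_metric M, bijective f &
        @measurable d V = [set f @^-1` B | B in <<s @open M >>]].

(* A graph on [V] is given by its adjacency relation; [rel V] is no
   restriction since [bool] and [Prop] relations are in correspondence
   classically. *)
Record borel_graph (R : realType) (d : measure_display)
    (V : measurableType d) (adj : rel V) : Prop := BorelGraph {
  borel_graph_vertex : standard_borel R V ;
  borel_graph_sym : symmetric adj ;
  borel_graph_irr : irreflexive adj ;
  borel_graph_adj : measurable [set p : V * V | adj p.1 p.2]
}.

Definition locally_finite (V : Type) (adj : rel V) : Prop :=
  forall x : V, finite_set [set y | adj x y].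

Section GraphMetric.
Variables (R : realType) (V : choiceType) (adj : rel V).

(* Length of a shortest walk, [+oo] (the infimum of the empty set) when there
   is none. *)
Definition gdist (x y : V) : \bar R :=
  ereal_inf [set (size p)%:R%:E | p in [set p : seq V | path adj x p /\ last x p = y]].

Definition gball (u : V) (r : R) : set V := [set v | gdist u v <= r%:E].

Definition growth (r : R) : \bar R :=
  ereal_sup [set counting (gball u r) | u in [set: V]].

(* The limsup is over real [r] tending to infinity. *)
Definition growth_rate : \bar R :=
  limf_esup (fun r : R => lne (growth r) / (ln (r + 1))%:E) (pinfty_nbhs R).

(* The diameter of the empty set is [-oo] here, which does not affect
   uniform boundedness. *)
Definition diam (A : set V) : \bar R :=
  ereal_sup [set gdist x y | x in A & y in A].

Definition set_gdist (A B : set V) : \bar R :=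
  ereal_inf [set gdist x y | x in A & y in B].

Definition uniformly_bounded (F : set (set V)) : Prop :=
  ereal_sup [set diam A | A in F] < +oo.

Definition r_disjoint (r : R) (F : set (set V)) : Prop :=
  forall A B, F A -> F B -> A <> B -> r%:E < set_gdist A B.

End GraphMetric.

Arguments gdist R {V} adj x y.
Arguments growth_rate R {V} adj.
Arguments uniformly_bounded R {V} adj F.

(* Borel subsets of the space of finite subsets of [V]: [F] consists of finite
   sets, and its preimage in the disjoint union of the [V^k] is Borel, i.e. each
   component of the preimage is. *)
Definition borel_family (d : measure_display) (V : measurableType d)
    (F : set (set V)) : Prop :=
  F `<=` [set A | finite_set A] /\
  forall k : nat, measurable [set t : k.-tuple V | F [set x | x \in t]].

Definition asdim_borel_le (R : realType) (d : measure_display)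
    (V : measurableType d) (adj : rel V) (n : nat) : Prop :=
  forall r : R, (0 < r)%R ->
    exists U : 'I_n.+1 -> set (set V),
      (forall i, [/\ borel_family (U i), uniformly_bounded R adj (U i) &
                     r_disjoint adj r (U i)]) /\
      (forall x : V, exists i A, U i A /\ A x).

(* The infimum of a set of natural numbers: its least element, or [+oo] if it
   is empty. *)
Definition asdim_borel (R : realType) (d : measure_display)
    (V : measurableType d) (adj : rel V) : \bar R :=
  ereal_inf [set n%:R%:E | n in [set n : nat | asdim_borel_le R adj n]].

(* Main.v *)
Require Import Defs.
From mathcomp Require Import finmap.
From mathcomp Require Import all_boot all_order all_algebra.
From mathcomp Require Import zify lra.
From mathcomp Require Import all_classical all_reals all_analysis.

Set Implicit Arguments.
Unset Strict Implicit.
Unset Printing Implicit Defensive.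

Import Order.TTheory GRing.Theory Num.Theory.
Import numFieldNormedType.Exports.

Local Open Scope classical_set_scope.

(** Let [n] be the integral part of the growth rate.  Given [r], the sets of the
    [n + 1] families are carved one family after the other, by region growing.
    Let [A] be the set of points not covered so far.  From a centre in [A], grow
    a ball by steps of [r] until one more step multiplies its number of points in
    [A] by at most [1 + 1/q]; keep the points of the ball as a cell, and discard
    for this round the shell of width [r] around it, so that the cells are at
    distance more than [r] from each other.  A shell has at most [1/q] times as
    many points as its cell.  As the cells are disjoint and their diameters are
    at most [D = 2 * m * r], where [m] bounds the number of steps, the uncovered
    points of a ball of radius [s] are at most [1/q] times the points of [A] in
    the concentric ball of radius [s + D] ([vol_uncovered]).  After [n + 1]
    rounds a vertex could be uncovered only if the ball of radius [(n + 1) * D]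
    around it had at least [q ^ (n + 1)] points.  The growth rate being less than
    [n + 1], [q] and [m] can be chosen so that this does not happen, and so that
    [m] steps suffice ([carving_parameters]).  If the growth rate is infinite
    there is nothing to prove.

    For the construction to be Borel, the centres are taken from countably many
    Borel sets, each without two points at small distance ([separated_cover]),
    which are treated in succession; and the neighbours of a vertex are
    enumerated by countably many Borel functions ([borel_neighbours]), so that a
    quantifier over a ball becomes a countable union.  Such an enumeration rests
    on a case of the Lusin-Novikov theorem: a Borel subset of the plane whose sections
    have at most [K] points has a Borel projection ([measurable_proj]).

    That theorem is proved in the Baire space, where a standard Borel space
    embeds ([standard_borel_embedding]).  A Borel set is there the injective
    projection of a closed set ([measurable_uniquely_souslin]), so that it is
    enough to project closed sets with fibres of at most [K] points; for these,
    the Lusin separation theorem ([lusin_separation]) and Koenig's lemma express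
    the existence of a point in the fibre by a Borel condition
    ([measurable_proj_closed]). *)

(** * Measurability of sets given by formulas *)

Section MeasurableFormulas.
Context d (T : measurableType d).
Implicit Types P Q : T -> Prop.

Lemma mprop_not P :
  measurable [set x | P x] -> measurable [set x | ~ P x].
Proof. exact: measurableC. Qed.

Lemma mprop_and P Q : measurable [set x | P x] ->
  measurable [set x | Q x] -> measurable [set x | P x /\ Q x].
Proof. exact: measurableI. Qed.

Lemma mprop_or P Q : measurable [set x | P x] ->
  measurable [set x | Q x] -> measurable [set x | P x \/ Q x].
Proof. exact: measurableU. Qed.

Lemma mprop_const (p : Prop) : measurable [set _ : T | p].
Proof.
have [hp|hp] := pselect p.
  by rewrite (_ : mkset _ = setT) //; apply/seteqP; split.
by rewrite (_ : mkset _ = set0) //; apply/seteqP; split.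
Qed.

Lemma mprop_imply P Q : measurable [set x | P x] ->
  measurable [set x | Q x] -> measurable [set x | P x -> Q x].
Proof.
move=> mP mQ; rewrite (_ : mkset _ = [set x | ~ P x \/ Q x]).
  by apply: mprop_or => //; exact: mprop_not.
apply/seteqP; split=> x /=; last by case.
by move=> h; have [/h|] := pselect (P x); [right|left].
Qed.

Lemma mprop_exists (I : countType) (P : I -> T -> Prop) :
  (forall i, measurable [set x | P i x]) ->
  measurable [set x | exists i, P i x].
Proof.
move=> mP; rewrite (_ : mkset _ = \bigcup_i [set x | P i x]).
  by apply: countable_bigcupT_measurable.
by apply/seteqP; split=> x /=; [case=> i Pi; exists i|case=> i _ Pi; exists i].
Qed.

Lemma mprop_forall (I : countType) (P : I -> T -> Prop) :
  (forall i, measurable [set x | P i x]) ->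
  measurable [set x | forall i, P i x].
Proof.
move=> mP; rewrite (_ : mkset _ = [set x | ~ exists i, ~ P i x]).
  by apply/mprop_not/mprop_exists => i; exact: mprop_not.
apply/seteqP; split=> x /=; first by move=> Px [i]; apply.
by move=> h i; apply: contrapT => nP; apply: h; exists i.
Qed.

Lemma mprop_preim d' (T' : measurableType d') (f : T -> T')
    (P : set T') : measurable_fun setT f ->
  measurable P -> measurable [set x | P (f x)].
Proof. by move=> mf /(mf measurableT); rewrite setTI. Qed.

End MeasurableFormulas.

(** * The Baire space *)

(** The sets [{a | a i = j}], which generate the Borel sets of the Baire
    space. *)
Definition cylinders : set (set (nat -> nat)) :=
  [set A | exists i j, A = [set a : nat -> nat | a i = j]].

(** Sequences of natural numbers, with the sigma-algebra generated by
    [cylinders]. *)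
Definition baire := g_sigma_algebraType cylinders.

(** [agree n a b]: the first [n] terms of [a] and [b] coincide.  This is how
    the product topology of the Baire space is expressed below. *)
Definition agree (n : nat) (a b : nat -> nat) := forall i, i < n -> a i = b i.

Lemma agree_sym n a b : agree n a b -> agree n b a.
Proof. by move=> ab i /ab. Qed.

Lemma agree_trans n a b c : agree n a b -> agree n b c -> agree n a c.
Proof. by move=> ab bc i lin; rewrite ab // bc. Qed.

Lemma agree_le m n a b : m <= n -> agree n a b -> agree m a b.
Proof. by move=> lemn ab i /leq_trans/(_ lemn)/ab. Qed.

Lemma agreeP (a b : nat -> nat) : (forall n, agree n a b) -> a = b.
Proof. by move=> ab; apply/funext => n; exact: (ab n.+1). Qed.

(** Closed sets, closed binary relations and continuous maps for the product
    topology. *)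
Definition closed_set (F : set baire) : Prop :=
  forall a, (forall n, exists2 a', agree n a a' & F a') -> F a.

Definition closed_rel (R : baire -> baire -> Prop) : Prop :=
  forall a b, (forall n, exists a' b', [/\ agree n a a', agree n b b' & R a' b']) ->
    R a b.

Definition continuous_map (f : baire -> baire) : Prop :=
  forall a n, exists m, forall b, agree m a b -> agree n (f a) (f b).

Lemma measurable_coord i j : measurable [set a : baire | a i = j].
Proof. by apply: sub_sigma_algebra; exists i, j. Qed.

Lemma measurable_agree n (b : baire) : measurable [set a : baire | agree n b a].
Proof.
apply: mprop_forall => i; apply: mprop_imply.
  exact: mprop_const.
rewrite (_ : mkset _ = [set a : baire | a i = b i]); first exact: measurable_coord.
by apply/seteqP; split=> a /= ->.
Qed.

(** * Borel sets are projections of closed sets with unique witnesses *)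

(** [P] is the image of a closed set of pairs of sequences by the first
    projection, which is injective on that closed set. *)
Definition uniquely_souslin (P : set baire) : Prop :=
  exists R : baire -> baire -> Prop,
    [/\ closed_rel R, forall a, P a <-> exists b, R a b &
        forall a b b', R a b -> R a b' -> b = b'].

Lemma closed_uniquely_souslin (P : set baire) :
  closed_set P -> uniquely_souslin P.
Proof.
move=> cP; exists (fun a b => P a /\ b = fun=> 0); split.
- move=> a b h; split.
    by apply: cP => n; have [a' [b' [aa' _ []]]] := h n; exists a'.
  by apply: agreeP => n; have [a' [b' [_ + [_ b'E]]]] := h n; rewrite b'E.
- by move=> a; split=> [Pa|[b []]//]; exists (fun=> 0).
- by move=> a b b' [_ ->] [_ ->].
Qed.

(** The sequence coded by [b] in the coordinates [pickle (n, _)]. *)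
Definition slice (b : nat -> nat) (n : nat) : nat -> nat :=
  fun j => b (pickle (n, j)).

Lemma uniquely_souslin_bigcap (P : nat -> set baire) :
  (forall n, uniquely_souslin (P n)) -> uniquely_souslin (\bigcap_n P n).
Proof.
move=> /choice[R hR].
(* The coordinates of a witness that code no pair must be zero, or else the
   witness would not be unique. *)
exists (fun a b => (forall n, R n a (slice b n)) /\
  forall k, pickle_inv k = None :> option (nat * nat) -> b k = 0); split.
- move=> a b h; split=> [n|k kN].
    have [cR _ _] := hR n; apply: cR => m.
    have [M lM] : exists M, forall j, j < m -> pickle (n, j) < M.
      exists (\max_(j < m) (pickle (n, j : nat)).+1) => j jm.
      exact: (leq_bigmax (Ordinal jm)).
    have [a' [b' [aa' bb' [Rab _]]]] := h (maxn m M).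
    exists a', (slice b' n); split => //.
      by apply: agree_le aa'; rewrite leq_maxl.
    move=> j jm; apply: bb'; rewrite (leq_trans (lM _ jm))// leq_maxr//.
  by have [a' [b' [_ /(_ _ (ltnSn k))-> [_ ->]]]] := h k.+1.
- move=> a; split=> [Pa|[b [Rb _]] n _]; last first.
    by have [_ PR _] := hR n; apply/PR; exists (slice b n).
  have /choice[c hc] : forall n, exists b, R n a b.
    by move=> n; have [_ PR _] := hR n; apply/PR; exact: Pa.
  exists (fun k => if pickle_inv k is Some (n, j) then c n j else 0); split.
    move=> n; rewrite (_ : slice _ n = c n) //.
    by apply/funext => j; rewrite /slice pickleK_inv.
  by move=> k ->.
- move=> a b b' [Rb b0] [Rb' b'0]; apply/funext => k.
  case E : (pickle_inv k : option (nat * nat)) => [[n j]|]; last first.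
    by rewrite b0 // b'0.
  have [_ _ uR] := hR n.
  have := pickle_invK (T := (nat * nat)%type) k; rewrite E /= => <-.
  exact: (congr1 (fun g : nat -> nat => g j) (uR _ _ _ (Rb n) (Rb' n))).
Qed.

Lemma uniquely_souslin_bigcup (P : nat -> set baire) :
  (forall n m a, P n a -> P m a -> n = m) ->
  (forall n, uniquely_souslin (P n)) -> uniquely_souslin (\bigcup_n P n).
Proof.
move=> dP /choice[R hR].
exists (fun a b => R (b 0) a (fun j => b j.+1)); split.
- move=> a b h; have [cR _ _] := hR (b 0); apply: cR => n.
  have [a' [b' [aa' bb' Rab]]] := h n.+1.
  exists a', (fun j => b' j.+1); split.
  + by apply: agree_le aa'.
  + by move=> j jn; apply: bb'.
  + by rewrite bb'.
- move=> a; split=> [[n _]|[b Rb]].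
    have [_ PR _] := hR n => /PR[b Rb].
    by exists (fun j => if j is j'.+1 then b j' else n).
  by exists (b 0) => //; have [_ PR _] := hR (b 0); apply/PR; eexists; exact: Rb.
- move=> a b b' Rb Rb'.
  have e : b 0 = b' 0.
    apply: (dP _ _ a).
      by have [_ PR _] := hR (b 0); apply/PR; eexists; exact: Rb.
    by have [_ PR _] := hR (b' 0); apply/PR; eexists; exact: Rb'.
  rewrite -e in Rb'; have [_ _ uR] := hR (b 0).
  have f := uR _ _ _ Rb Rb'.
  apply/funext => -[//|j].
  exact: (congr1 (fun g : nat -> nat => g j) f).
Qed.

Lemma uniquely_souslinI (P Q : set baire) :
  uniquely_souslin P -> uniquely_souslin Q -> uniquely_souslin (P `&` Q).
Proof.
move=> uP uQ; rewrite (_ : P `&` Q = \bigcap_n (if n is 0 then P else Q)).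
  by apply: uniquely_souslin_bigcap => -[].
apply/seteqP; split=> [a [Pa Qa] [|n] _ //|a h].
by split; [exact: (h 0)|exact: (h 1)].
Qed.

(** Every Borel subset of the Baire space is the injective projection of a
    closed set: the sets which have this property together with their
    complement form a sigma-algebra, because a countable union can be made
    disjoint. *)
Lemma measurable_uniquely_souslin (P : set baire) :
  measurable P -> uniquely_souslin P.
Proof.
pose G : set (set baire) := [set A | uniquely_souslin A /\ uniquely_souslin (~` A)].
suff /(_ P)GP : <<s cylinders >> `<=` G by move=> /GP[].
apply: smallest_sub; last first.
  move=> _ [i [j ->]]; split; apply: closed_uniquely_souslin => a h.
    by have [a' aa' /= <-] := h i.+1; exact: aa'.
  by have [a' aa' a'N] := h i.+1 => /= ai; apply: a'N; rewrite /= -aa'.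
split.
- split; first by apply: closed_uniquely_souslin => a /(_ 0)[].
  by rewrite setC0; apply: closed_uniquely_souslin.
- by move=> A [uA uCA]; rewrite setTD; split=> //; rewrite setCK.
- move=> A /all_and2[uA uCA]; split; last first.
    by rewrite setC_bigcup; exact: uniquely_souslin_bigcap.
  rewrite (_ : \bigcup_k A k =
    \bigcup_k (A k `&` \bigcap_n (if n < k then ~` A n else setT))); last first.
    apply/seteqP; split=> [a [k _ Aka]|a [k _ [Aka _]]]; last by exists k.
    have ex : exists k, `[< A k a >] by exists k; apply/asboolP.
    case: (ex_minnP ex) => m /asboolP Am lem; exists m => //; split=> // n _.
    case: ifPn => // nm An.
    by have /lem := asboolT An; rewrite leqNgt nm.
  apply: uniquely_souslin_bigcup => [n m a [An hn] [Am hm]|n].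
    case: (ltngtP n m) => // [nm|mn].
      by have := hm n I; rewrite nm => /(_ An).
    by have := hn m I; rewrite mn => /(_ Am).
  apply: uniquely_souslinI => //; apply: uniquely_souslin_bigcap => k.
  by case: ifP => // _; exact: closed_uniquely_souslin.
Qed.

(** * Separation of analytic sets *)

(** The sets [A i] can be enlarged to Borel sets with no common point. *)
Definition borel_separated k (A : 'I_k -> set baire) : Prop :=
  exists B : 'I_k -> set baire,
    [/\ forall i, measurable (B i), forall i, A i `<=` B i &
        forall x, exists i, ~ B i x].

Lemma borel_separated_bigcup k (A : 'I_k -> set baire)
    (C : 'I_k -> nat -> set baire) :
  (forall i, A i `<=` \bigcup_n C i n) ->
  (forall nu : {ffun 'I_k -> nat}, borel_separated (fun i => C i (nu i))) ->
  borel_separated A.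
Proof.
move=> AC /choice[B hB].
exists (fun i => [set x | exists n, forall nu : {ffun 'I_k -> nat},
  nu i = n -> B nu i x]); split.
- move=> i; apply: mprop_exists => n; apply: mprop_forall => nu.
  apply: mprop_imply; first exact: mprop_const.
  by have [mB _ _] := hB nu; exact: mB.
- move=> i x /AC[n _ Cx]; exists n => nu nuE.
  by have [_ CB _] := hB nu; apply: CB; rewrite nuE.
- move=> x; apply: contrapT => h.
  have /choice[nu hnu] : forall i, exists n, forall nu : {ffun 'I_k -> nat},
      nu i = n -> B nu i x.
    by move=> i; apply: contrapT => hi; apply: h; exists i.
  have [_ _ /(_ x)[i]] := hB [ffun i => nu i].
  by apply; apply: hnu; rewrite ffunE.
Qed.

(** The Lusin separation theorem, for finitely many continuous images of closed
    sets: if no point belongs to all of them, then they are contained in Borel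
    sets with the same property. *)
Lemma lusin_separation k (F : 'I_k -> set baire) (f : baire -> baire) :
  (forall i, closed_set (F i)) -> continuous_map f ->
  (forall g : 'I_k -> baire, (forall i, F i (g i)) ->
    exists i j, f (g i) <> f (g j)) ->
  borel_separated (fun i => f @` F i).
Proof.
move=> cF cf hF; apply: contrapT => nsep.
pose NS t (g : 'I_k -> baire) :=
  ~ borel_separated (fun i => f @` (F i `&` [set a | agree t (g i) a])).
(* Nonseparation passes from some prefixes of length [t] to some prefixes of
   length [t.+1]; in the limit, these prefixes define points [a i] of the sets
   [F i]. *)
have step t g : exists g', NS t g ->
    NS t.+1 g' /\ forall i, agree t (g i) (g' i).
  have [nsg|] := pselect (NS t g); last by exists g.
  pose put n i : baire := fun p => if p == t then n else g i p.
  have putE n i : agree t (g i) (put n i).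
    by move=> p pt; rewrite /put ltn_eqF.
  apply: contrapT => hN; apply: nsg.
  apply: (@borel_separated_bigcup _ _
    (fun i n => f @` (F i `&` [set a | agree t.+1 (put n i) a]))).
    move=> i _ [a [Fa ga] <-]; exists (a t) => //; exists a => //; split=> // p.
    by rewrite ltnS leq_eqVlt /put => /predU1P[->|pt]; rewrite ?eqxx// ltn_eqF// ga.
  move=> nu; apply: contrapT => nsnu; apply: hN.
  by exists (fun i => put (nu i) i).
have [nxt hnxt] := choice (fun tg => step tg.1 tg.2).
pose G := fix G t := if t is t'.+1 then nxt (t', G t') else fun=> (fun=> 0) : baire.
have NSG t : NS t (G t).
  elim: t => [|t IH]; last by have [] := hnxt (t, G t) IH.
  move=> h; apply: nsep; have [B [mB AB nB]] := h.
  by exists B; split=> // i _ [a Fa <-]; apply: AB; exists a => //; split.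
have Gagree t s i : agree t (G t i) (G (t + s) i).
  elim: s => [|s IH]; first by rewrite addn0.
  apply: (agree_trans IH); rewrite addnS.
  have [_ /(_ i)] := hnxt (t + s, G (t + s)) (NSG _).
  by apply: agree_le; rewrite leq_addr.
pose a i : baire := fun j => G j.+1 i j.
have aG t i : agree t (G t i) (a i).
  move=> j jt; have := Gagree j.+1 (t - j.+1) i j (ltnSn j).
  by rewrite subnKC // => <-.
have nsa t : NS t a.
  move=> [B [mB AB nB]]; apply: (NSG t); exists B; split=> // i _ [b [Fb Gb] <-].
  apply: AB; exists b => //; split=> //.
  exact: agree_trans (agree_sym (aG t i)) Gb.
have Fa i : F i (a i).
  apply: cF => n; apply: contrapT => hn; apply: (nsa n).
  exists (fun j => if j == i then set0 else setT); split.
  - by move=> j; case: ifP => _; [exact: measurable0|exact: measurableT].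
  - move=> j; case: ifP => // /eqP-> y [b [Fb ab] _].
    by apply: hn; exists b.
  - by move=> x; exists i; rewrite eqxx.
(* The images of [a i] and [a j] differ at a coordinate [p], and [F i] and [F j]
   are separated near these points by the value of that coordinate. *)
have [i [j fij]] := hF a Fa.
have [p fp] : exists p, f (a i) p <> f (a j) p.
  apply: contrapT => h; apply: fij; apply/funext => p.
  by apply: contrapT => hp; apply: h; exists p.
have [m hm] := cf (a i) p.+1; have [m' hm'] := cf (a j) p.+1.
apply: (nsa (maxn m m')).
exists (fun l => if l == i then [set x : baire | x p = f (a i) p] else
                 if l == j then [set x : baire | x p = f (a j) p] else setT); split.
- move=> l; case: ifP => _; first exact: measurable_coord.
  by case: ifP => _; [exact: measurable_coord|exact: measurableT].
- move=> l; case: ifP => [/eqP->|_].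
    move=> _ [b [_ ab] <-] /=; apply/esym/hm => //.
    by apply: agree_le ab; rewrite leq_maxl.
  case: ifP => // /eqP-> _ [b [_ ab] <-] /=; apply/esym/hm' => //.
  by apply: agree_le ab; rewrite leq_maxr.
- move=> x; have [xi|xi] := pselect (x p = f (a i) p); last first.
    by exists i; rewrite eqxx.
  exists j; rewrite eqxx; case: ifP => [/eqP e|_ /=]; last by rewrite xi.
  by move: fp; rewrite e.
Qed.

(** * Projections with finite fibres *)

(** Koenig's lemma, for a tree [T] of finite sequences which has at most [K]
    nodes at each level. *)
Lemma koenig (T : seq nat -> Prop) (K : nat) :
  (forall s n, T (rcons s n) -> T s) ->
  (forall n (l : seq (seq nat)), uniq l ->
    (forall s, s \in l -> size s = n /\ T s) -> size l <= K) ->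
  (forall n, exists2 s, size s = n & T s) ->
  exists e : nat -> nat, forall n, T (mkseq e n).
Proof.
move=> Tr TK Tex.
have Tcat s t : T (s ++ t) -> T s.
  elim/last_ind: t => [|t n IH]; first by rewrite cats0.
  by rewrite -rcons_cat => /Tr.
pose big s := forall m, exists2 t, size t = m & T (s ++ t).
have step s : exists n, big s -> big (rcons s n).
  have [bs|] := pselect (big s); last by exists 0.
  apply: contrapT => h.
  have /choice[m hm] : forall n, exists m, forall t, size t = m ->
      ~ T (rcons s n ++ t).
    move=> n; apply: contrapT => hn; apply: h; exists n => _ m.
    by apply: contrapT => hm; apply: hn; exists m => t tm Tt; apply: hm; exists t.
  have finC : finite_set [set n | T (rcons s n)].
    apply: contrapT => /(infinite_set_fset K.+1)[B BT].
    rewrite ltnNge => /negP; apply.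
    rewrite -(size_map (rcons s)).
    apply: (TK (size s).+1).
      by rewrite map_inj_uniq; [exact: fset_uniq|move=> n n' /rcons_inj[]].
    by move=> _ /mapP[n nB ->]; split; [rewrite size_rcons|exact: BT].
  have [M hM] : exists M, forall n, T (rcons s n) -> m n <= M.
    exists (\max_(n <- fset_set [set n | T (rcons s n)]) m n) => n Tn.
    by apply: leq_bigmax_seq => //; rewrite in_fset_set// inE.
  have [[|n t]// tM Tst] := bs M.+1.
  rewrite -cat_rcons in Tst.
  have le : m n <= M by apply: hM; exact: Tcat Tst.
  apply: (hm n (take (m n) t)).
    by rewrite size_takel//; move: tM => [->].
  apply: (@Tcat _ (drop (m n) t)).
  by rewrite -catA cat_take_drop.
have [nxt hnxt] := choice step.
pose S := fix S n := if n is n'.+1 then rcons (S n') (nxt (S n')) else [::].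
have bS n : big (S n).
  elim: n => [|n IH]; last exact: hnxt.
  by move=> m; have [s sm Ts] := Tex m; exists s.
exists (fun n => nxt (S n)) => n.
have -> : mkseq (fun n => nxt (S n)) n = S n.
  by elim: n => // n IH; rewrite mkseqS IH.
by have [t _ /Tcat] := bS n 0.
Qed.

(** [a] and [e] as the even and the odd terms of one sequence. *)
Definition join (a e : nat -> nat) : nat -> nat :=
  fun i => if odd i then e i./2 else a i./2.
Definition evens (c : nat -> nat) : nat -> nat := fun i => c i.*2.
Definition odds (c : nat -> nat) : nat -> nat := fun i => c i.*2.+1.

Lemma evens_join a e : evens (join a e) = a.
Proof. by apply/funext => i; rewrite /evens /join odd_double doubleK. Qed.

Lemma odds_join a e : odds (join a e) = e.
Proof.
by apply/funext => i; rewrite /odds /join /= odd_double /= uphalf_double.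
Qed.

Lemma join_evens_odds c : join (evens c) (odds c) = c.
Proof.
apply/funext => i; rewrite /join /evens /odds; case: ifPn => oi.
  by rewrite -{2}(odd_double_half i) oi.
by rewrite -{2}(odd_double_half i) (negbTE oi).
Qed.

Lemma agree_evens n c c' : agree n.*2 c c' -> agree n (evens c) (evens c').
Proof. by move=> h i lin; apply: h; rewrite ltn_double. Qed.

Lemma agree_odds n c c' : agree n.*2 c c' -> agree n (odds c) (odds c').
Proof. by move=> h i lin; apply: h; rewrite ltn_Sdouble. Qed.

Lemma agree_join n a a' e e' :
  agree n a a' -> agree n e e' -> agree n (join a e) (join a' e').
Proof.
move=> aa ee i lin; have h : i./2 < n.
  apply: leq_ltn_trans lin.
  by rewrite leq_half_double (leq_trans (leqnSn _))// -addnn ltnS leq_addr.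
by rewrite /join aa // ee.
Qed.

Lemma mkseq_agree n a b : mkseq a n = mkseq b n <-> agree n a b.
Proof.
split=> [h i lin|h].
  by rewrite -(nth_mkseq 0 a lin) h nth_mkseq.
by apply: (@eq_from_nth _ 0); rewrite ?size_mkseq// => i lin; rewrite !nth_mkseq// h.
Qed.

(** The projection of a closed set whose fibres have at most [K] points is
    Borel.  The points over [a] are the branches of a tree of Borel conditions
    on [a]: by the separation theorem the conditions can be chosen so that, at
    each level of the tree, at most [K] of them hold at the same time, and
    Koenig's lemma turns the existence of a branch into a Borel condition. *)
Lemma measurable_proj_closed (Q : baire -> baire -> Prop) (K : nat) :
  closed_rel Q ->
  (forall a (e : 'I_K.+1 -> baire), (forall i, Q a (e i)) ->
    exists i j, i <> j /\ e i = e j) ->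
  measurable [set a : baire | exists e, Q a e].
Proof.
move=> cQ fQ.
(* A sequence in [F s] codes a point (its even terms) and a witness over it (its
   odd terms) which extends [s]. *)
pose F s : set baire :=
  [set c | Q (evens c) (odds c) /\ mkseq (odds c) (size s) = s].
have cF s : closed_set (F s).
  move=> c h; split.
    apply: cQ => n; have [c' cc' [Qc _]] := h n.*2.
    by exists (evens c'), (odds c'); split=> //; [exact: agree_evens|exact: agree_odds].
  have [c' cc' [_ <-]] := h (size s).*2; rewrite size_mkseq.
  by apply/mkseq_agree/agree_odds.
have cev : continuous_map evens.
  by move=> a n; exists n.*2 => b; exact: agree_evens.
(* The sets of points with a witness extending [s], for [K.+1] distinct [s] of
   the same length, have no common point: they can be separated. *)
pose good (t : K.+1.-tuple (seq nat)) :=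
  uniq t /\ exists n, forall i, size (tnth t i) = n.
have /choice[B hB] : forall t, exists B : 'I_K.+1 -> set baire, good t ->
    [/\ forall i, measurable (B i), forall i, evens @` F (tnth t i) `<=` B i &
        forall x, exists i, ~ B i x].
  move=> t; have [[ut [n tn]]|] := pselect (good t); last by exists (fun=> set0).
  suff [B hB] : borel_separated (fun i => evens @` F (tnth t i)) by exists B.
  apply: lusin_separation => // g Fg; apply: contrapT => h.
  have ev i j : evens (g i) = evens (g j).
    by apply: contrapT => hij; apply: h; exists i, j.
  have [|i [j [ij oij]]] := fQ (evens (g ord0)) (fun i => odds (g i)).
    by move=> i; rewrite (ev ord0 i); have [] := Fg i.
  apply: ij; have /tuple_uniqP := ut; apply.
  have [_ <-] := Fg i; have [_ <-] := Fg j.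
  by rewrite !tn; apply/mkseq_agree; rewrite oij.
(* The Borel condition at the node [s]: [a] is in the closure of the set of
   points with a witness extending [s], and in all the separating sets of [s]. *)
pose hull s : set baire := [set a |
  (forall n, exists b : n.-tuple nat, mkseq a n = b /\
     exists2 c, F s c & mkseq (evens c) n = b) /\
  (forall t i, good t /\ tnth t i = s -> B t i a)].
have mhull s : measurable (hull s).
  apply: mprop_and.
    apply: mprop_forall => n; apply: mprop_exists => b.
    apply: mprop_and; last exact: mprop_const.
    have [[b' b'b]|nb] := pselect (exists b' : baire, mkseq b' n = b); last first.
      rewrite (_ : mkset _ = set0) //; apply/seteqP; split=> // a /= ab.
      by apply: nb; exists a.
    rewrite (_ : mkset _ = [set a : baire | agree n b' a]).
      exact: measurable_agree.
    apply/seteqP; split=> a /=; rewrite -b'b; first by move/esym/mkseq_agree.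
    by move/mkseq_agree/esym.
  apply: mprop_forall => t; apply: mprop_forall => i.
  have [gt|ngt] := pselect (good t /\ tnth t i = s).
    apply: mprop_imply; first exact: mprop_const.
    by have [+ _ _] := hB t gt.1; exact.
  by rewrite (_ : mkset _ = setT) //; apply/seteqP; split=> // a _ /ngt.
rewrite (_ : mkset _ = [set a : baire | forall n, exists s : seq nat,
    size s = n /\ forall m, hull (take m s) a]).
  apply: mprop_forall => n; apply: mprop_exists => s.
  apply: mprop_and; first exact: mprop_const.
  by apply: mprop_forall => m; exact: mhull.
apply/seteqP; split=> [a [e Qae] n|a /= h].
  exists (mkseq e n); split=> [|m]; first by rewrite size_mkseq.
  have Fe : F (take m (mkseq e n)) (join a e).
    split; rewrite ?evens_join odds_join //.
    apply: (@eq_from_nth _ 0); rewrite size_mkseq// => i lin.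
    rewrite nth_mkseq//; move: lin; rewrite size_take_min leq_min size_mkseq.
    by move=> /andP[im lin]; rewrite nth_take// nth_mkseq.
  split=> [p|t i [gt ti]].
    exists (Tuple (introT eqP (size_mkseq a p))); split=> //.
    by exists (join a e) => //; rewrite evens_join.
  have [_ + _] := hB t gt; apply; exists (join a e); last by rewrite evens_join.
  by rewrite ti.
have [|||e he] := @koenig (fun s => forall m, hull (take m s) a) K.
- move=> s n hs m; have [le|lt] := leqP m (size s).
    by have := hs m; rewrite -cats1 takel_cat.
  by have := hs (size s); rewrite -cats1 takel_cat// take_size take_oversize// ltnW.
- move=> n l ul hl; rewrite leqNgt; apply/negP => Kl.
  have sl : size (take K.+1 l) == K.+1 by rewrite size_takel.
  pose t := Tuple sl.
  have gt : good t.
    split; first exact: take_uniq.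
    by exists n => i; have [] := hl _ (mem_take (mem_tnth i t)).
  have [_ _ /(_ a)[i]] := hB t gt; apply.
  have [_ /(_ n)] := hl _ (mem_take (mem_tnth i t)).
  rewrite take_oversize; last by have [<-] := hl _ (mem_take (mem_tnth i t)).
  by case=> _; apply.
- by move=> n; have [s []] := h n; exists s.
exists e; apply: cQ => n.
have [/(_ n)[b [ab [c [Qc oc] ec]]] _] := he n n.
rewrite take_oversize ?size_mkseq// in oc.
exists (evens c), (odds c); split => //.
  by apply/mkseq_agree; rewrite ab ec.
by apply/agree_sym/mkseq_agree.
Qed.

(** * Borel embeddings into the Baire space *)

Lemma mprop_coord i (P : nat -> Prop) : measurable [set a : baire | P (a i)].
Proof.
rewrite (_ : mkset _ = [set a : baire | exists j, a i = j /\ P j]).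
  apply: mprop_exists => j; apply: mprop_and; first exact: measurable_coord.
  exact: mprop_const.
by apply/seteqP; split=> a /=; [exists (a i)|case=> j [-> ]].
Qed.

Lemma mprop_coord2 i k (P : nat -> nat -> Prop) :
  measurable [set a : baire | P (a i) (a k)].
Proof.
rewrite (_ : mkset _ = [set a : baire | exists j, a i = j /\ P j (a k)]).
  apply: mprop_exists => j; apply: mprop_and; first exact: measurable_coord.
  exact: mprop_coord.
by apply/seteqP; split=> a /=; [exists (a i)|case=> j [-> ]].
Qed.

Lemma measurable_fun_baire d (T : measurableType d) (h : T -> baire) :
  (forall i j, measurable [set x | h x i = j]) -> measurable_fun setT h.
Proof.
move=> mh; apply: (@measurability _ _ T baire setT h cylinders erefl).
by move=> _ [_ [i [j ->]] <-]; rewrite setTI; exact: mh.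
Qed.

Lemma measurable_evens : measurable_fun setT (evens : baire -> baire).
Proof. by apply: measurable_fun_baire => i j; exact: measurable_coord. Qed.

Lemma measurable_odds : measurable_fun setT (odds : baire -> baire).
Proof. by apply: measurable_fun_baire => i j; exact: measurable_coord. Qed.

(** An injection with a Borel range maps the sigma-algebra generated by [G] to
    Borel sets as soon as it does so for [G]. *)
Lemma measurable_image (T : Type) (c : T -> baire) (G : set (set T)) :
  injective c -> measurable (range c) ->
  (forall A, G A -> measurable (c @` A)) ->
  forall A, <<s G >> A -> measurable (c @` A).
Proof.
move=> ic mr mG A sA; move: A sA; apply: smallest_sub => //; split.
- by rewrite image_set0.
- move=> A mA; rewrite setTD.
  rewrite (_ : c @` _ = range c `\` c @` A); first exact: measurableD.
  apply/seteqP; split=> [_ [x nA <-]|_ [[x _ <-] nA]].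
    by split; [exists x|case=> y Ay /ic yx; apply: nA; rewrite -yx].
  by exists x => // Ax; apply: nA; exists x.
- by move=> A mA; rewrite image_bigcup; exact: bigcup_measurable.
Qed.

(** A Borel isomorphism of [V] with a Borel subset of the Baire space. *)
Definition borel_embedding d (V : measurableType d) (c : V -> baire) : Prop :=
  [/\ injective c, measurable_fun setT c &
      forall A, measurable A -> measurable (c @` A)].

Section PolishCode.
Context (R : realType) (M : metricType R).
Local Open Scope ring_scope.

Let e (j : nat) : R := j.+1%:R^-1.

Let e_gt0 j : 0 < e j. Proof. by rewrite invr_gt0. Qed.

Let e_lt (x : R) : 0 < x -> exists m0, forall m, (m0 <= m)%N -> e m < x.
Proof. by move=> x0; have [N _ h] := near_infty_natSinv_lt (PosNum x0); exists N. Qed.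

Let open_ball (x : M) r : open [set y | mdist x y < r].
Proof.
rewrite openE => y /= xy; rewrite /interior.
have h : 0 < r - mdist x y by rewrite subr_gt0.
apply: (filterS _ (nbhsx_ballx y _ h)) => z; rewrite ballEmdist /= ltrBrDl => yz.
exact: le_lt_trans (metric_triangle _ _ _) yz.
Qed.

Let dense_sequence (D : set M) (x0 : M) : countable D -> dense D ->
  exists p : nat -> M, forall x (r : R), 0 < r -> exists n, mdist x (p n) < r.
Proof.
move=> /countable_injP[f] fi dD.
have /choice[p hp] : forall n, exists y, forall z, D z -> f z = n -> y = z.
  move=> n; have [[z [Dz <-]]|h] := pselect (exists z, D z /\ f z = n).
    by exists z => w Dw /fi; rewrite !inE => ->.
  by exists x0 => z Dz fz; exfalso; apply: h; exists z.
exists p => x r r0; have [|z [xz Dz]] := dD [set y | mdist x y < r] _ (open_ball x r).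
  by exists x; rewrite /= mdistxx.
by exists (f z); rewrite (hp _ z).
Qed.

(** A Polish space embeds in the Baire space: given a dense sequence [p], the
    point [x] is coded by the sequence whose [j]-th term is the least [i] such
    that [p i] is at distance less than [1/(j+1)] from [x]. *)
Lemma polish_code (x0 : M) : polish_metric M ->
  exists c : M -> baire, [/\ injective c,
    forall d (V : measurableType d) (f : V -> M),
      (forall U, open U -> measurable (f @^-1` U)) ->
      forall i j, measurable [set v | c (f v) i = j] &
    forall A, <<s @open M >> A -> measurable (c @` A)].
Proof.
move=> [cplt [D cD dD]]; have [p hp] := dense_sequence x0 cD dD.
have ex x j : exists i, mdist x (p i) < e j by exact: hp.
pose c : M -> baire := fun x j => ex_minn (ex x j).
have cP x j i : c x j = i <-> mdist x (p i) < e j /\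
    (forall k, (k < i)%N -> ~ mdist x (p k) < e j).
  rewrite /c; case: ex_minnP => n pn mn; split=> [<-|[pi mi]].
    by split=> // k kn /mn; rewrite leqNgt kn.
  apply/eqP; rewrite eqn_leq mn//= leqNgt; apply/negP => /mi; exact.
have cd x j : mdist x (p (c x j)) < e j by have [] := (cP x j (c x j)).1 erefl.
have lim0 (x y : M) : (forall j, mdist x y <= e j + e j) -> x = y.
  move=> h; apply: mdist_positivity; apply/eqP; rewrite eq_le mdist_ge0 andbT.
  apply/ler_addgt0Pl => r r0; rewrite addr0.
  have [m /(_ _ (leqnn m)) hm] := e_lt (divr_gt0 r0 (ltr0Sn R 1)).
  apply: (le_trans (h m)); rewrite [leRHS](splitr r).
  by rewrite lerD// ltW.
have ic : injective c.
  move=> x y xy; apply: lim0 => j; apply: (le_trans (metric_triangle _ (p (c x j)) _)).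
  by rewrite lerD// ltW// metric_sym xy.
(* [S] is the set of codes.  If [x] is the limit of the points [p (a m)], then
   [close a i j] says that [p i] is at distance less than [e j] from [x], without
   mentioning [x]. *)
pose close (a : baire) i j := exists m, mdist (p (a m)) (p i) + e m < e j.
pose S : set baire := [set a |
  (forall j k, mdist (p (a j)) (p (a k)) < e j + e k) /\
  (forall j, close a (a j) j /\ forall i, (i < a j)%N -> ~ close a i j)].
have closeP (a : baire) x : (forall m, mdist x (p (a m)) <= e m) ->
    forall i j, close a i j <-> mdist x (p i) < e j.
  move=> xa i j; split=> [[m]|xi].
    apply: le_lt_trans; apply: (le_trans (metric_triangle _ (p (a m)) _)).
    by rewrite addrC lerD2l.
  have : 0 < e j - mdist x (p i) by rewrite subr_gt0.
  move=> /divr_gt0/(_ (ltr0Sn R 1))/e_lt[m /(_ _ (leqnn m)) hm].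
  exists m; rewrite -ltrBrDr.
  apply: (le_lt_trans (metric_triangle _ x _)).
  rewrite metric_sym (le_lt_trans (lerD (xa m) (lexx _)))//.
  rewrite ltrBrDr addrAC -ltrBrDr (splitr (_ - _)).
  by rewrite ltrD.
have rS : range c = S.
  apply/seteqP; split=> [_ [x _ <-]|a [aC aS]].
    have xc m : mdist x (p (c x m)) <= e m by rewrite ltW.
    split=> [j k|j].
      apply: (le_lt_trans (metric_triangle _ x _)).
      by rewrite metric_sym ltrD.
    split=> [|i ij]; first by apply/(closeP _ _ xc).
    by move=> /(closeP _ _ xc); have [_ ] := (cP x j (c x j)).1 erefl; apply.
  have [x xl] : exists x : M, (fun n : nat => p (a n)) @ \oo --> x.
    refine (cplt _ _ _); apply/cauchy_ballP => r r0.
    have [m hm] := e_lt (divr_gt0 r0 (ltr0Sn R 1)).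
    pose A := [set x : M | exists2 n, (m <= n)%N & x = p (a n)].
    have nA : \forall n \near \oo, A (p (a n)) by exists m => // n mn; exists n.
    exists (A, A) => // -[_ _] /= [[j mj ->] [k mk ->]]; rewrite ballEmdist /=.
    by rewrite (lt_trans (aC j k))// (splitr r) ltrD// hm.
  have xa m : mdist x (p (a m)) <= e m.
    apply/ler_addgt0Pl => r r0.
    have [N hN] := e_lt (divr_gt0 r0 (ltr0Sn R 1)).
    have [N' _ hN'] := xl _ (nbhsx_ballx x _ (divr_gt0 r0 (ltr0Sn R 1))).
    have := hN' _ (leq_maxr N N'); rewrite /= ballEmdist /= => h1.
    apply: (le_trans (metric_triangle _ (p (a (maxn N N'))) _)).
    have h2 := aC (maxn N N') m; have h3 := hN _ (leq_maxl N N').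
    by move: h1 h2 h3; lra.
  exists x => //; apply/funext => j; apply/cP.
  have [aj hj] := aS j; split; first by apply/(closeP _ _ xa).
  by move=> k /hj h /(closeP _ _ xa).
have mS : measurable S.
  apply: mprop_and.
    by apply: mprop_forall => j; apply: mprop_forall => k;
      exact: (mprop_coord2 j k (fun u v => mdist (p u) (p v) < e j + e k)).
  apply: mprop_forall => j; apply: mprop_and.
    by apply: mprop_exists => m;
      exact: (mprop_coord2 m j (fun u v => mdist (p u) (p v) + e m < e j)).
  apply: mprop_forall => i; apply: mprop_imply.
    exact: (mprop_coord j (fun v => (i < v)%N)).
  apply: mprop_not; apply: mprop_exists => m.
  exact: (mprop_coord m (fun v => mdist (p v) (p i) + e m < e j)).
exists c; split=> //.
- move=> d V f mf i j.
  rewrite (_ : mkset _ = [set v | mdist (f v) (p j) < e i /\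
      forall k, (k < j)%N -> ~ mdist (f v) (p k) < e i]); last first.
    by apply/seteqP; split=> v /= /cP.
  have mb k : measurable [set v | mdist (f v) (p k) < e i].
    rewrite (_ : mkset _ = f @^-1` [set y | mdist (p k) y < e i]).
      exact/mf/open_ball.
    by apply/seteqP; split=> v /=; rewrite metric_sym.
  apply: mprop_and; first exact: mb.
  apply: mprop_forall => k; apply: mprop_imply; first exact: mprop_const.
  exact/mprop_not/mb.
- apply: measurable_image => //; first by rewrite rS.
  move=> U oU; rewrite (_ : c @` U = S `&` [set a | exists j,
      [set y | mdist (p (a j)) y < e j] `<=` U]).
    apply: measurableI => //; apply: mprop_exists => j.
    exact: (mprop_coord j (fun v => [set y | mdist (p v) y < e j] `<=` U)).
  rewrite -rS; apply/seteqP; split=> [_ [x Ux <-]|_ [[x _ <-] [j hj]]].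
    split; first by exists x.
    move: oU; rewrite openE => /(_ _ Ux); rewrite /interior.
    move=> /nbhs_ballP[r /= r0 rU].
    have [m /(_ _ (leqnn m)) hm] := e_lt (divr_gt0 r0 (ltr0Sn R 1)).
    exists m => y /= py; apply: rU; rewrite ballEmdist /=.
    apply: (le_lt_trans (metric_triangle _ (p (c x m)) _)).
    by rewrite (splitr r) ltrD// (lt_trans _ hm).
  by exists x => //; apply: hj; rewrite /= metric_sym.
Qed.

End PolishCode.

Lemma standard_borel_embedding (R : realType) d (V : measurableType d) :
  standard_borel R V -> exists c : V -> baire, borel_embedding c.
Proof.
move=> [M [f [pM bf mV]]].
have [c [ic mc imc]] := polish_code (f point) pM.
exists (c \o f); split.
- exact: inj_comp ic (bij_inj bf).
- apply: measurable_fun_baire; apply: mc => U oU.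
  by rewrite mV; exists U => //; exact: sub_sigma_algebra.
- move=> A; rewrite mV => -[B mB <-].
  rewrite -image_comp; rewrite image_preimage; first exact: imc.
  have [g fg gf] := bf; apply/seteqP; split=> // x _.
  by exists (g x).
Qed.

(** A Borel subset of the plane with sections of at most [K] points has a Borel
    projection. *)
Lemma measurable_proj d (V : measurableType d) (c : V -> baire) (P : set (V * V))
    (K : nat) : borel_embedding c -> measurable P ->
  (forall x (y : 'I_K.+1 -> V), (forall i, P (x, y i)) ->
    exists i j, i <> j /\ y i = y j) ->
  measurable [set x | exists y, P (x, y)].
Proof.
move=> [ic mc imc] mP fP.
pose cc (p : V * V) : baire := join (c p.1) (c p.2).
have icc : injective cc.
  move=> [x y] [x' y'] h; congr (_, _); apply: ic.
    by have := congr1 evens h; rewrite !evens_join.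
  by have := congr1 odds h; rewrite !odds_join.
have mX A B : measurable A -> measurable B -> measurable (cc @` (A `*` B)).
  move=> mA mB; rewrite (_ : _ @` _ = [set a : baire |
      (c @` A) (evens a) /\ (c @` B) (odds a)]).
    apply: mprop_and.
      by apply: (mprop_preim measurable_evens); exact: imc.
    by apply: (mprop_preim measurable_odds); exact: imc.
  apply/seteqP; split=> [_ [[x y] [/= Ax By] <-]|a /= [[x Ax xa] [y By ya]]].
    by rewrite /cc /= evens_join odds_join; split; [exists x|exists y].
  by exists (x, y) => //; rewrite /cc /= xa ya join_evens_odds.
have /measurable_uniquely_souslin[Q [cQ PQ uQ]] : measurable (cc @` P).
  move: P mP {fP}; rewrite measurable_prod_measurableType.
  apply: measurable_image => //.
    by rewrite -setXTT; exact: mX.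
  by move=> _ [A mA [B mB <-]]; exact: mX.
have m : measurable [set a : baire | exists e, Q (join a (evens e)) (odds e)].
  apply: (measurable_proj_closed (K := K)).
    move=> a e h; apply: cQ => n.
    have [a' [e' [aa' ee' Qe]]] := h n.*2.
    exists (join a' (evens e')), (odds e'); split => //.
      apply: agree_join; last exact: agree_evens.
      by apply: agree_le aa'; rewrite -addnn leq_addr.
    exact: agree_odds.
  move=> a e Qe.
  have /choice[xy hxy] : forall i, exists p, P p /\ cc p = join a (evens (e i)).
    move=> i; have [_ /(_ (ex_intro _ _ (Qe i)))[p Pp pe]] := PQ (join a (evens (e i))).
    by exists p.
  have cx i : c (xy i).1 = a.
    by have [_ /(congr1 evens)] := hxy i; rewrite !evens_join.
  have cy i : c (xy i).2 = evens (e i).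
    by have [_ /(congr1 odds)] := hxy i; rewrite !odds_join.
  have [|i [j [ij yij]]] := fP (xy ord0).1 (fun i => (xy i).2).
    move=> i; rewrite (_ : (xy ord0).1 = (xy i).1); last by apply: ic; rewrite !cx.
    by rewrite -surjective_pairing; have [] := hxy i.
  exists i, j; split=> //.
  have eij : evens (e i) = evens (e j) by rewrite -!cy yij.
  rewrite -(join_evens_odds (e i)) -(join_evens_odds (e j)) eij; congr join.
  by apply: uQ (Qe i) _; rewrite eij; exact: Qe.
rewrite (_ : mkset _ = [set x | exists e, Q (join (c x) (evens e)) (odds e)]).
  exact: (mprop_preim mc m).
apply/seteqP; split=> [x [y Pxy]|x [e Qe]] /=.
  have [h _] := PQ (join (c x) (c y)).
  have [|e Qe] := h; first by exists (x, y).
  by exists (join (c y) e); rewrite evens_join odds_join.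
have [_ /(_ (ex_intro _ _ Qe))[[x' y] Pxy exy]] := PQ (join (c x) (evens e)).
exists y; rewrite (_ : x = x') //; apply: ic.
by have := congr1 evens exy; rewrite !evens_join.
Qed.

(** * Counting and region growing *)

(** If the numbers [v j] would all grow by a factor [1 + 1/q], then [v m] would
    be too large. *)
Lemma slow_growth_step (v : nat -> nat) m q g : 0 < v 0 -> v m <= g ->
  q ^ m * g < q.+1 ^ m -> exists2 j, j < m & q * v j.+1 <= q.+1 * v j.
Proof.
move=> v0 vm hg; apply: contrapT => h.
have grow j : j < m -> q.+1 * v j < q * v j.+1.
  by move=> jm; rewrite ltnNge; apply/negP => le; apply: h; exists j.
have : q.+1 ^ m <= q ^ m * v m.
  have : forall j, j <= m -> q.+1 ^ j <= q ^ j * v j.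
    elim=> [|j IH] jm; first by rewrite !expn0 mul1n.
    rewrite !expnS; apply: leq_trans (_ : q.+1 * (q ^ j * v j) <= _).
      by rewrite leq_mul2l IH ?orbT// ltnW.
    by rewrite mulnCA [q * q ^ j]mulnC -mulnA leq_mul2l ltnW ?orbT// grow.
  exact.
by rewrite leqNgt (leq_ltn_trans _ hg)// leq_mul2l vm orbT.
Qed.

(** If each fibre of [f] in [Z] is charged, with a factor [q], to a set [C i],
    and these sets are disjoint subsets of [W], then [Z] is charged to [W]. *)
Lemma leq_card_charge (T I : choiceType) (Z W : {fset T}) (f : T -> I)
    (C : I -> {fset T}) (q : nat) :
  (forall z, z \in Z -> (C (f z) `<=` W)%fset) ->
  (forall z z' w, z \in Z -> z' \in Z -> w \in C (f z) -> w \in C (f z') ->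
     f z = f z') ->
  (forall z, z \in Z -> q * #|` [fset y in Z | f y == f z]%fset | <= #|` C (f z)|) ->
  q * #|` Z| <= #|` W|.
Proof.
move=> CW dC ch.
pose K := [fset f z | z in Z]%fset.
have KP i : i \in K -> exists2 z, z \in Z & i = f z.
  by move=> /imfsetP[z /= zZ ->]; exists z.
have cardU (F : I -> {fset T}) :
    (forall i j, i \in K -> j \in K -> i != j -> [disjoint F i & F j]%fset) ->
    #|` (\bigcup_(i <- K) F i)%fset | = \sum_(i <- K) #|` F i|.
  move=> dF; rewrite -sum1_size partition_disjoint_bigfcup//.
  by apply: eq_bigr => i _; rewrite sum1_size.
pose fib i := [fset y in Z | f y == i]%fset.
apply: (@leq_trans (q * #|` (\bigcup_(i <- K) fib i)%fset |)).
  rewrite leq_mul2l; apply/orP; right; apply/fsubset_leq_card/fsubsetP => z zZ.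
  apply/bigfcupP; exists (f z); last by rewrite !inE /= zZ eqxx.
  by rewrite andbT; apply/imfsetP; exists z.
rewrite cardU => [|i j _ _ ij]; last first.
  apply/fdisjointP => z; rewrite !inE => /andP[/= _ /eqP zi]; rewrite zi (negbTE ij).
  by rewrite andbF.
apply: (@leq_trans #|` (\bigcup_(i <- K) C i)%fset |); last first.
  apply/fsubset_leq_card/bigfcupsP => i /KP[z zZ ->] _; exact: CW.
rewrite cardU => [|i j /KP[z zZ ->] /KP[z' z'Z ->] ij].
  rewrite big_distrr /= big_seq [leqRHS]big_seq; apply: leq_sum => i /KP[z zZ ->].
  exact: ch.
apply/fdisjointP => w wz; apply/negP => wz'; move/eqP: ij; apply.
exact: dC wz wz'.
Qed.

Lemma mprop_eq d d' (T : measurableType d) (V : measurableType d')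
    (c : V -> baire) (f g : T -> V) : borel_embedding c ->
  measurable_fun setT f -> measurable_fun setT g ->
  measurable [set x | f x = g x].
Proof.
move=> [ic mc _] mf mg.
rewrite (_ : mkset _ = [set x | forall i, exists j, c (f x) i = j /\ c (g x) i = j]).
  apply: mprop_forall => i; apply: mprop_exists => j; apply: mprop_and.
    by apply: (mprop_preim (P := fun y => c y i = j) mf);
      exact: (mprop_preim (P := fun a : baire => a i = j) mc (measurable_coord i j)).
  by apply: (mprop_preim (P := fun y => c y i = j) mg);
    exact: (mprop_preim (P := fun a : baire => a i = j) mc (measurable_coord i j)).
apply/seteqP; split=> [x /= -> i|x /= h]; first by exists (c (g x) i).
by apply: ic; apply/funext => i; have [j [-> ->]] := h i.
Qed.

(** * Ball carving *)

(** The relation [near s x y] stands for [dist x y <= s] in a graph with finite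
    balls; the ball [near s x] is enumerated by the Borel functions [psi s n]. *)
Record enumerated_balls d (V : measurableType d) (near : nat -> V -> V -> Prop)
    (psi : nat -> nat -> V -> V) : Prop := EnumeratedBalls {
  near_eq : forall x y, near 0 x y <-> x = y ;
  near_sym : forall s x y, near s x y -> near s y x ;
  near_trans : forall s t x y z, near s x y -> near t y z -> near (s + t) x z ;
  near_leq : forall s t x y, s <= t -> near s x y -> near t x y ;
  near_fin : forall s x, finite_set [set y | near s x y] ;
  psi_meas : forall s n, measurable_fun setT (psi s n) ;
  psiP : forall s x y, near s x y <-> exists n, psi s n x = y }.

Section Carving.
Context d (V : measurableType d) (near : nat -> V -> V -> Prop).
Context (psi : nat -> nat -> V -> V) (c : V -> baire).
Hypothesis hN : enumerated_balls near psi.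
Hypothesis hc : borel_embedding c.

Lemma near_refl s x : near s x x.
Proof. by apply: (near_leq hN (leq0n s)); apply/(near_eq hN). Qed.

(** The number of points of [S] in the ball of radius [s] around [x]. *)
Definition vol (S : set V) (x : V) (s : nat) : nat :=
  #|` fset_set [set y | S y /\ near s x y]|.

Lemma vol_finite S x s : finite_set [set y | S y /\ near s x y].
Proof. by apply: (sub_finite_set _ (near_fin hN s x)) => y []. Qed.

Lemma mem_vol (S : set V) x s y :
  y \in fset_set [set y | S y /\ near s x y] <-> S y /\ near s x y.
Proof. by rewrite in_fset_set; [rewrite inE|exact: vol_finite]. Qed.

(** The volume is at least [k] when [k] of the functions [psi s] take distinct
    values in [S]; this is a Borel condition on the centre. *)
Lemma leq_vol k S x s : k <= vol S x s <-> exists n : k.-tuple nat,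
  (forall i, S (psi s (tnth n i) x)) /\
  (forall i j, psi s (tnth n i) x = psi s (tnth n j) x -> i = j).
Proof.
split=> [kv|[n [Sn inj]]].
  pose B := fset_set [set y | S y /\ near s x y].
  have /choice[e he] : forall i : 'I_k, exists n, psi s n x = nth x B i.
    move=> i; apply/(psiP hN).
    have /mem_vol[] // : nth x B i \in B.
    by rewrite mem_nth// (leq_trans (ltn_ord i)).
  exists [tuple e i | i < k]; split=> [i|i j]; rewrite !tnth_mktuple !he.
    have /mem_vol[] // : nth x B i \in B.
    by rewrite mem_nth// (leq_trans (ltn_ord i)).
  move=> /eqP; rewrite nth_uniq ?fset_uniq ?(leq_trans (ltn_ord _))//.
  by move=> /eqP/val_inj.
have uB : uniq [seq psi s m x | m <- n].
  apply/(uniqP x) => i j; rewrite !inE !size_map size_tuple => ik jk.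
  rewrite !(nth_map 0) ?size_tuple//.
  rewrite -(tnth_nth 0 n (Ordinal ik)) -(tnth_nth 0 n (Ordinal jk)).
  by move=> /inj[].
rewrite -(size_tuple n) -(size_map (fun m => psi s m x)).
apply: uniq_leq_size => // y /mapP[m mn ->].
apply/mem_vol; have /tnthP[i ->] := mn; split=> //.
by apply/(psiP hN); exists (tnth n i).
Qed.

Lemma measurable_leq_vol k S s : measurable S ->
  measurable [set x | k <= vol S x s].
Proof.
move=> mS; rewrite (_ : mkset _ = [set x | exists n : k.-tuple nat,
  (forall i, S (psi s (tnth n i) x)) /\
  (forall i j, psi s (tnth n i) x = psi s (tnth n j) x -> i = j)]).
  apply: mprop_exists => n; apply: mprop_and.
    by apply: mprop_forall => i; exact: (mprop_preim (psi_meas hN _ _)).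
  apply: mprop_forall => i; apply: mprop_forall => j.
  apply: mprop_imply; last exact: mprop_const.
  by apply: (mprop_eq hc); exact: (psi_meas hN).
by apply/seteqP; split=> x /leq_vol.
Qed.

Lemma measurable_vol S s k : measurable S -> measurable [set x | vol S x s = k].
Proof.
move=> mS; rewrite (_ : mkset _ =
    [set x | k <= vol S x s /\ ~ k.+1 <= vol S x s]).
  apply: mprop_and; first exact: measurable_leq_vol.
  by apply: mprop_not; exact: measurable_leq_vol.
apply/seteqP; split=> x /=; first by move=> <-; rewrite ltnn.
by move=> [le /negP]; rewrite -leqNgt => ge; apply/eqP; rewrite eqn_leq ge.
Qed.

Lemma mprop_near d' (T : measurableType d') s (f g : T -> V) :
  measurable_fun setT f -> measurable_fun setT g ->
  measurable [set t | near s (f t) (g t)].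
Proof.
move=> mf mg; rewrite (_ : mkset _ = [set t | exists n, psi s n (f t) = g t]).
  apply: mprop_exists => n; apply: (mprop_eq hc) => //.
  by apply: measurableT_comp => //; exact: (psi_meas hN).
by apply/seteqP; split=> t /(psiP hN).
Qed.

(** [q] and [m] govern the carving: the ball around a centre grows, by steps of
    [r], as long as its volume is multiplied by more than [1 + 1/q], which happens
    fewer than [m] times.  The centres are taken successively in the sets [W k];
    two centres in the same [W k] are more than [2 * m * r + r] apart. *)
Variables (r m q : nat) (W : nat -> set V).
Hypothesis mW : forall k, measurable (W k).
Hypothesis W_cover : forall x, exists k, W k x.
Hypothesis W_sep : forall k x y, W k x -> W k y -> near (m * r + m * r + r) x y ->
  x = y.

(** One more step from radius [j * r] does not multiply the volume by more than
    [1 + 1/q]. *)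
Definition slow (S : set V) (x : V) (j : nat) : Prop :=
  j < m /\ q * vol S x (j.+1 * r) <= q.+1 * vol S x (j * r).

(** The ball around [x] stops growing in [S] after [j] steps. *)
Definition radius (S : set V) (x : V) (j : nat) : Prop :=
  slow S x j /\ forall i, i < j -> ~ slow S x i.

(** The cell of the centre [x], when [S] is the set of remaining points. *)
Definition cell (S : set V) (x : V) : set V :=
  [set z | S z /\ exists j, radius S x j /\ near (j * r) x z].

(** The part of [A] that is left when the centres of [W 0], ..., [W k.-1] have
    been treated: the cells are removed, and the points at distance at most
    [r] from them. *)
Fixpoint remains (A : set V) (k : nat) : set V :=
  if k is k'.+1 then
    [set z | remains A k' z /\ ~ exists x j, [/\ W k' x, remains A k' x,
       radius (remains A k') x j & near (j.+1 * r) x z]]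
  else A.

(** The cells carved out of [A], from all centres. *)
Definition cells (A : set V) : set (set V) :=
  [set C | exists k x, [/\ W k x, remains A k x & C = cell (remains A k) x]].

(** The points of [A] which belong to no cell: they are the input of the next
    round. *)
Definition uncovered (A : set V) : set V :=
  [set z | A z /\ ~ exists k x, [/\ W k x, remains A k x &
    cell (remains A k) x z]].

Lemma measurable_slow S j : measurable S -> measurable [set x | slow S x j].
Proof.
move=> mS; apply: mprop_and; first exact: mprop_const.
rewrite (_ : mkset _ = [set x | exists a b, [/\ vol S x (j.+1 * r) = a,
   vol S x (j * r) = b & q * a <= q.+1 * b]]).
  apply: mprop_exists => a; apply: mprop_exists => b.
  rewrite (_ : mkset _ = [set x | vol S x (j.+1 * r) = a /\
    (vol S x (j * r) = b /\ q * a <= q.+1 * b)]).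
    apply: mprop_and; first exact: measurable_vol.
    by apply: mprop_and; [exact: measurable_vol|exact: mprop_const].
  by apply/seteqP; split=> x /=; [case|case=> ? []].
by apply/seteqP; split=> x /=; [move=> h; do 2 eexists; split|case=> a [b [<- <-]]].
Qed.

Lemma measurable_radius S j : measurable S -> measurable [set x | radius S x j].
Proof.
move=> mS; apply: mprop_and; first exact: measurable_slow.
apply: mprop_forall => i; apply: mprop_imply; first exact: mprop_const.
by apply: mprop_not; exact: measurable_slow.
Qed.

Lemma radius_uniq S x i j : radius S x i -> radius S x j -> i = j.
Proof.
by move=> [si mi] [sj mj]; case: (ltngtP i j) => // [/mj/(_ si)|/mi/(_ sj)].
Qed.

Lemma radius_ltn S x j : radius S x j -> j < m. Proof. by case=> -[]. Qed.

Lemma measurable_remains A k : measurable A -> measurable (remains A k).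
Proof.
move=> mA; elim: k => // k IH.
rewrite (_ : remains A k.+1 = [set z | remains A k z /\ ~ exists j n,
    (W k (psi (j.+1 * r) n z) /\ remains A k (psi (j.+1 * r) n z)) /\
    radius (remains A k) (psi (j.+1 * r) n z) j]).
  apply: mprop_and; first exact: IH.
  apply: mprop_not; apply: mprop_exists => j; apply: mprop_exists => n.
  have mf := psi_meas hN (j.+1 * r) n.
  apply: mprop_and; first apply: mprop_and.
  - by apply: (mprop_preim mf); exact: mW.
  - by apply: (mprop_preim mf); exact: IH.
  - apply: (mprop_preim (P := fun x => radius (remains A k) x j) mf).
    exact: measurable_radius.
apply/seteqP; split=> z /= [Rz h]; split=> //.
  move=> [j [n [[Wx Rx] rj]]]; apply: h; exists (psi (j.+1 * r) n z), j; split=> //.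
  by apply/(near_sym hN)/(psiP hN); exists n.
move=> [x [j [Wx Rx rj]]] /(near_sym hN)/(psiP hN)[n xn].
by apply: h; exists j, n; rewrite xn.
Qed.

Lemma remains_leq A k l : k <= l -> remains A l `<=` remains A k.
Proof.
move=> /subnKC <-; elim: (l - k) => [|i IH]; first by rewrite addn0.
by rewrite addnS => z [/IH].
Qed.

(** [g] bounds the volume of the balls of radius [m * r]; by [qmg], the balls then
    stop growing before [m] steps. *)
Section Volume.
Variable g : nat.
Hypothesis vol_bound : forall x, vol setT x (m * r) <= g.
Hypothesis qmg : q ^ m * g < q.+1 ^ m.

Lemma vol_sub S S' x s s' : (forall y, S y -> near s x y -> S' y /\ near s' x y) ->
  vol S x s <= vol S' x s'.
Proof.
by move=> h; apply/fsubset_leq_card/fsubsetP => y /mem_vol[Sy xy]; apply/mem_vol/h.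
Qed.

Lemma radius_exists S x : S x -> exists j, radius S x j.
Proof.
move=> Sx.
have [||j jm hj] := @slow_growth_step (fun j => vol S x (j * r)) m q g _ _ qmg.
- rewrite cardfs_gt0; apply/fset0Pn; exists x; apply/mem_vol; split=> //.
  exact: near_refl.
- by apply: leq_trans (vol_bound x); exact: vol_sub.
have ex : exists j, `[< slow S x j >] by exists j; apply/asboolP.
case: (ex_minnP ex) => i /asboolP si mi; exists i; split=> // l li /asboolP/mi.
by rewrite leqNgt li.
Qed.

Lemma center_cell S x : S x -> cell S x x.
Proof.
move=> Sx; split=> //; have [j rj] := radius_exists Sx.
by exists j; split=> //; exact: near_refl.
Qed.

Lemma near_cell S x z : cell S x z -> near (m * r) x z.
Proof.
move=> [_ [j [/radius_ltn jm]]]; apply: (near_leq hN).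
by rewrite leq_mul2r ltnW ?orbT.
Qed.

(** The cells of different centres are at distance more than [r]: if the
    centres belong to the same [W k], because these centres are far away;
    otherwise, because of the points removed around the first cell. *)
Lemma cell_sep A k k' x x' a b : W k x -> remains A k x ->
  W k' x' -> remains A k' x' ->
  cell (remains A k) x a -> cell (remains A k') x' b -> near r a b ->
  (k, x) = (k', x').
Proof.
wlog le : k k' x x' a b / k <= k'.
  move=> H; have [le|/ltnW le] := leqP k k'; first exact: H.
  by move=> Wx Rx Wx' Rx' Ca Cb /(near_sym hN) ab; apply/esym; apply: H Cb Ca ab.
move=> Wx Rx Wx' Rx' Ca Cb ab.
move: le; rewrite leq_eqVlt => /predU1P[kk|lt].
  subst k'; congr (_, _); apply: W_sep Wx Wx' _.
  have xb := near_trans hN (near_cell Ca) ab.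
  have := near_trans hN xb (near_sym hN (near_cell Cb)).
  by rewrite addnAC.
have [Rb _] := Cb; have [_ [j [rj xa]]] := Ca.
have [_ []] := remains_leq lt Rb; exists x, j; split=> //.
by rewrite mulSn addnC; exact: (near_trans hN xa ab).
Qed.

(** Every point of [A] which is in no cell was removed around some cell. *)
Lemma uncovered_removed A z : uncovered A z -> exists k x j,
  [/\ W k x, remains A k x, radius (remains A k) x j & remains A k z /\
      (near (j.+1 * r) x z /\ ~ near (j * r) x z)].
Proof.
move=> [Az nz]; have [k0 Wz] := W_cover z.
have nR : ~ remains A k0.+1 z.
  move=> [Rz h]; apply: nz; exists k0, z; split=> //; exact: center_cell.
have ex : exists k, `[< ~ remains A k.+1 z >] by exists k0; apply/asboolP.
case: (ex_minnP ex) => k /asboolP nRk mk.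
have Rk : remains A k z.
  case: k nRk mk => // k nRk mk; apply: contrapT => h.
  by have /mk := asboolT h; rewrite ltnn.
apply: contrapT => h; apply: nRk; split=> // -[x [j [Wx Rx rj xz]]].
apply: h; exists k, x, j; split=> //; split=> //; split=> // jxz.
by apply: nz; exists k, x; split=> //; split=> //; exists j.
Qed.

(** The points left uncovered are fewer than those of [A] by a factor [q], up to
    an enlargement of the ball: the shell around a cell is charged to that
    cell. *)
Lemma vol_uncovered A y s :
  q * vol (uncovered A) y s <= vol A y (s + (m * r + m * r)).
Proof.
have /choice[f hf] : forall z, exists kx : nat * V, uncovered A z -> exists j,
   [/\ W kx.1 kx.2, remains A kx.1 kx.2, radius (remains A kx.1) kx.2 j &
     remains A kx.1 z /\ (near (j.+1 * r) kx.2 z /\ ~ near (j * r) kx.2 z)].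
  move=> z; have [uz|] := pselect (uncovered A z); last by exists (0, z).
  by have [k [x [j h]]] := uncovered_removed uz; exists (k, x) => _; exists j.
have finC S x : finite_set (cell S x).
  by apply: (sub_finite_set _ (near_fin hN (m * r) x)) => z /near_cell.
have memC S x z : z \in fset_set (cell S x) <-> cell S x z.
  by rewrite in_fset_set// inE.
apply: (@leq_card_charge _ _ _ _ f
   (fun kx => fset_set (cell (remains A kx.1) kx.2))).
- move=> z /mem_vol[uz yz]; have [j [Wx Rx rj [Rz [xz _]]]] := hf z uz.
  apply/fsubsetP => w /memC Cw; apply/mem_vol; split.
    by case: Cw => /(remains_leq (leq0n _)).
  rewrite addnA; apply: (near_trans hN) (near_cell Cw).
  apply: (near_trans hN yz); apply: (near_sym hN); apply: (near_leq hN) xz.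
  by rewrite leq_mul2r (radius_ltn rj) orbT.
- move=> z z' w /mem_vol[uz _] /mem_vol[uz' _] /memC Cw /memC Cw'.
  have [j [Wx Rx _ _]] := hf z uz; have [j' [Wx' Rx' _ _]] := hf z' uz'.
  rewrite (surjective_pairing (f z)) (surjective_pairing (f z')).
  by apply: cell_sep Cw Cw' _ => //; exact: near_refl.
- move=> z /mem_vol[uz yz]; have [j [Wx Rx rj [Rz [xz nxz]]]] := hf z uz.
  set Sh := [fset y0 in _ | _]%fset; set S := remains A (f z).1.
  set x := (f z).2.
  have CE : cell S x = [set y | S y /\ near (j * r) x y].
    apply/seteqP; split=> w; last by case=> Sw xw; split=> //; exists j.
    by move=> [Sw [i [ri xw]]]; split=> //; rewrite (radius_uniq rj ri).
  rewrite CE -/(vol _ _ _).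
  have h : #|` Sh| + vol S x (j * r) <= vol S x (j.+1 * r).
    rewrite -[X in X <= _]cardfsUI [X in _ + #|` X|](_ : _ = fset0).
      rewrite cardfs0 addn0; apply/fsubset_leq_card/fsubsetP => w.
      rewrite !in_fsetU => /orP[|/mem_vol[Sw xw]]; last first.
        apply/mem_vol; split=> //; apply: (near_leq hN) xw.
        by rewrite leq_mul2r leqnSn orbT.
      rewrite !inE => /andP[/= /mem_vol[uw _] /eqP wz]; apply/mem_vol.
      have [i [_ _ ri [Rw [xw _]]]] := hf w uw.
      by move: ri Rw xw; rewrite wz => ri; rewrite (radius_uniq ri rj).
    apply/fsetP => w; rewrite !inE; apply/negP => /andP[].
    move=> /andP[/= /mem_vol[uw _] /eqP wz] /mem_vol[Sw xw].
    have [i [_ _ ri [Rw [_ nxw]]]] := hf w uw.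
    by move: ri nxw; rewrite wz => ri; rewrite (radius_uniq ri rj).
  have [[_ sl] _] := rj; rewrite -/S -/x in sl.
  have := leq_trans (leq_mul (leqnn q) h) sl.
  by rewrite mulnDr mulSn leq_add2r.
Qed.

Lemma measurable_uncovered A : measurable A -> measurable (uncovered A).
Proof.
move=> mA; rewrite (_ : uncovered A = [set z | A z /\ ~ exists k j n,
   ((W k (psi (j * r) n z) /\ remains A k (psi (j * r) n z)) /\
   (radius (remains A k) (psi (j * r) n z) j /\ remains A k z))]).
  apply: mprop_and => //; apply: mprop_not.
  apply: mprop_exists => k; apply: mprop_exists => j; apply: mprop_exists => n.
  have mf := psi_meas hN.
  apply: mprop_and; apply: mprop_and.
  - by apply: (mprop_preim (mf _ _)); exact: mW.
  - by apply: (mprop_preim (mf _ _)); exact: measurable_remains.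
  - apply: (mprop_preim (P := fun x => radius (remains A k) x j) (mf _ _)).
    by apply: measurable_radius; exact: measurable_remains.
  - exact: measurable_remains.
apply/seteqP; split=> z /= [Az h]; split=> //.
  move=> [k [j [n [[Wx Rx] [rj Rz]]]]]; apply: h; exists k, (psi (j * r) n z).
  split=> //; split=> //; exists j; split=> //.
  by apply/(near_sym hN)/(psiP hN); exists n.
move=> [k [x [Wx Rx [Rz [j [rj]]]]]] /(near_sym hN)/(psiP hN)[n xn].
by apply: h; exists k, j, n; rewrite xn.
Qed.

Lemma cells_sep A C C' a b : cells A C -> cells A C' ->
  C a -> C' b -> near r a b -> C = C'.
Proof.
move=> [k [x [Wx Rx ->]]] [k' [x' [Wx' Rx' ->]]] Ca Cb ab.
by have [-> ->] := cell_sep Wx Rx Wx' Rx' Ca Cb ab.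
Qed.

Lemma cells_near A C a b : cells A C -> C a -> C b ->
  near (m * r + m * r) a b.
Proof.
move=> [k [x [_ _ ->]]] /near_cell xa /near_cell.
exact: (near_trans hN (near_sym hN xa)).
Qed.

Lemma cells_borel A : measurable A -> borel_family (cells A).
Proof.
move=> mA; split=> [_ [k [x [_ _ ->]]]|p].
  by apply: (sub_finite_set _ (near_fin hN (m * r) x)) => z /near_cell.
rewrite (_ : mkset _ = [set t : p.-tuple V | exists k i j,
   ((W k (tnth t i) /\ remains A k (tnth t i)) /\
   radius (remains A k) (tnth t i) j) /\
   ((forall i', remains A k (tnth t i') /\ near (j * r) (tnth t i) (tnth t i')) /\
    forall n, remains A k (psi (j * r) n (tnth t i)) ->
      exists i', tnth t i' = psi (j * r) n (tnth t i))]).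
  apply: mprop_exists => k; apply: mprop_exists => i; apply: mprop_exists => j.
  have mt i' : measurable_fun setT (fun t : p.-tuple V => tnth t i').
    exact: measurable_tnth.
  have mR := measurable_remains k mA.
  have mf n : measurable_fun setT (fun t : p.-tuple V => psi (j * r) n (tnth t i)).
    by apply: measurableT_comp => //; exact: (psi_meas hN).
  apply: mprop_and; apply: mprop_and.
  - apply: mprop_and; first by apply: (mprop_preim (mt _)); exact: mW.
    exact: (mprop_preim (mt _)).
  - apply: (mprop_preim (P := fun x => radius (remains A k) x j) (mt i)).
    exact: measurable_radius.
  - apply: mprop_forall => i'; apply: mprop_and; first exact: (mprop_preim (mt _)).
    exact: mprop_near.
  - apply: mprop_forall => n; apply: mprop_imply; first exact: (mprop_preim (mf _)).
    by apply: mprop_exists => i'; exact: (mprop_eq hc).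
apply/seteqP; split=> t /=.
  move=> [k [x [Wx Rx tE]]]; have [j rj] := radius_exists Rx.
  have tP z : z \in t <-> remains A k z /\ near (j * r) x z.
    have -> : (z \in t : Prop) = cell (remains A k) x z by rewrite -tE.
    split=> [[Sz [i [ri xz]]]|[Sz xz]]; last by split=> //; exists j.
    by split=> //; rewrite (radius_uniq rj ri).
  have /tnthP[i xi] : x \in t by apply/tP; split=> //; exact: near_refl.
  exists k, i, j; rewrite -xi; split; first by [].
  split=> [i'|n Rn]; first by apply/tP; exact: mem_tnth.
  have /tnthP[i' ->] : psi (j * r) n x \in t; last by exists i'.
  by apply/tP; split=> //; apply/(psiP hN); exists n.
move=> [k [i [j [[[Wx Rx] rj] [h1 h2]]]]]; exists k, (tnth t i); split=> //.
apply/seteqP; split=> z /=.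
  move=> /tnthP[i' ->]; have [Ri xi] := h1 i'; split=> //.
  by exists j.
move=> [Rz [j' [rj' xz]]]; rewrite (radius_uniq rj' rj) in xz.
have /(psiP hN)[n nz] := xz.
have [|i' i'z] := h2 n; first by rewrite nz.
by rewrite -nz -i'z mem_tnth.
Qed.

End Volume.
End Carving.

(** The codes of the points of a finite set have distinct prefixes of some
    length. *)
Lemma separating_length d (V : measurableType d) (c : V -> baire) (A : set V) :
  injective c -> finite_set A ->
  exists n, forall y y', A y -> A y' -> agree n (c y) (c y') -> y = y'.
Proof.
move=> ic fA.
have /choice[p hp] : forall yy : V * V, exists p, c yy.1 p = c yy.2 p -> yy.1 = yy.2.
  move=> yy; apply: contrapT => h.
  have e : c yy.1 = c yy.2.
    by apply/funext => p; apply: contrapT => np; apply: h; exists p => /np.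
  by apply: h; exists 0 => _; exact: ic.
exists (\max_(y <- fset_set A) \max_(y' <- fset_set A) (p (y, y')).+1).
move=> y y' Ay Ay' h; apply: (hp (y, y')); apply: h => /=.
have yA : y \in fset_set A by rewrite in_fset_set// inE.
have y'A : y' \in fset_set A by rewrite in_fset_set// inE.
apply: (@leq_trans (\max_(z <- fset_set A) (p (y, z)).+1)).
  exact: (leq_bigmax_seq (F := fun z => (p (y, z)).+1) y' y'A isT).
exact: (leq_bigmax_seq (F := fun y => \max_(z <- fset_set A) (p (y, z)).+1) y yA isT).
Qed.

(** For every [L], countably many Borel sets cover [V] and each of them has no two
    points at distance at most [L]: the code of [x] has an initial segment which
    it shares with no other point of the ball of radius [L] around [x]. *)
Lemma separated_cover d (V : measurableType d) near psi (c : V -> baire) (L : nat) :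
  enumerated_balls near psi -> borel_embedding c ->
  exists W : nat -> set V, [/\ forall k, measurable (W k),
    forall x, exists k, W k x &
    forall k x y, W k x -> W k y -> near L x y -> x = y].
Proof.
move=> hN hc; have [ic mc _] := hc.
pose code s : set baire := [set a | forall i, i < size s -> a i = nth 0 s i].
have mcode s : measurable (code s).
  apply: mprop_forall => i; apply: mprop_imply; first exact: mprop_const.
  exact: measurable_coord.
exists (fun k => [set x | exists s : seq nat, pickle s = k /\ (code s (c x) /\
  forall n, code s (c (psi L n x)) -> psi L n x = x)]); split.
- move=> k; apply: mprop_exists => s; apply: mprop_and; first exact: mprop_const.
  apply: mprop_and; first exact: (mprop_preim mc).
  apply: mprop_forall => n; apply: mprop_imply.
    apply: (mprop_preim (P := code s \o c) (psi_meas hN L n)).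
    exact: (mprop_preim mc).
  by apply: (mprop_eq hc) => //; exact: (psi_meas hN).
- move=> x; have [n hn] := separating_length ic (near_fin hN L x).
  exists (pickle (mkseq (c x) n)), (mkseq (c x) n); split=> //.
  have codeE y : code (mkseq (c x) n) (c y) <-> agree n (c y) (c x).
    split=> h i; have := h i; rewrite size_mkseq => + lin => /(_ lin);
      by rewrite nth_mkseq.
  split=> [|k]; rewrite codeE // => h.
  apply: hn h; first by apply/(psiP hN); exists k.
  exact: (near_refl hN).
- move=> k x y [s [sk [sx hx]]] [s' [s'k [sy hy]]] /(psiP hN)[n nxy].
  have ss : s' = s by apply: (pcan_inj pickleK); rewrite s'k.
  by have := hx n; rewrite nxy -ss => ->.
Qed.

(** * Balls of a locally finite Borel graph *)

Section Walks.
Context (V : choiceType) (adj : rel V).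

(** There is a walk of length at most [s] from [x] to [y]. *)
Definition walk (s : nat) (x y : V) : Prop :=
  exists p, [/\ path adj x p, last x p = y & size p <= s].

Lemma walk0 x y : walk 0 x y <-> x = y.
Proof.
split=> [[p [_ <-]]|->]; last by exists [::].
by rewrite leqn0 size_eq0 => /eqP->.
Qed.

Lemma walkS s x y : walk s.+1 x y <-> exists z, walk s x z /\ (z = y \/ adj z y).
Proof.
split=> [[p [pp <- ps]]|[z [[p [pp <- ps]] [<-|zy]]]].
- case: (lastP p) pp ps => [_ _|p' z pp ps].
    by exists x; split; [exists [::]|left].
  exists (last x p'); rewrite last_rcons.
  move: pp; rewrite rcons_path => /andP[pp pz]; split; last by right.
  by exists p'; split=> //; move: ps; rewrite size_rcons.
- by exists p; split=> //; exact: leqW.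
- exists (rcons p y); rewrite rcons_path last_rcons size_rcons.
  by split=> //; rewrite pp.
Qed.

Lemma walk_sym s x y : symmetric adj -> walk s x y -> walk s y x.
Proof.
move=> adj_sym [p [pp py ps]]; exists (rev (belast x p)); split.
- by rewrite -py rev_path; rewrite (eq_path (e' := adj)) // => u v; rewrite adj_sym.
- rewrite -py; case: p {pp py ps} => //= z p.
  by rewrite rev_cons last_rcons.
- by rewrite size_rev size_belast.
Qed.

Lemma walk_trans s t x y z : walk s x y -> walk t y z -> walk (s + t) x z.
Proof.
move=> [p [pp py ps]] [p' [pp' pz ps']]; exists (p ++ p').
by rewrite cat_path last_cat size_cat py pp pp' leq_add.
Qed.

Lemma walk_leq s t x y : s <= t -> walk s x y -> walk t x y.
Proof. by move=> st [p [pp py ps]]; exists p; split=> //; exact: leq_trans st. Qed.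

Lemma walk_fin s x : locally_finite adj -> finite_set [set y | walk s x y].
Proof.
move=> hfin; elim: s => [|s IH].
  by apply: (sub_finite_set _ (finite_set1 x)) => y /walk0 ->.
apply: (@sub_finite_set _ _
  (\bigcup_(z in [set z | walk s x z]) ([set z] `|` [set y | adj z y]))).
  by move=> y /walkS[z [xz [<-|zy]]]; exists z => //; [left|right].
apply: bigcup_finite => // z _; rewrite finite_setU.
by split=> //.
Qed.

(** The number of points of the closed ball of radius [s] around [x]. *)
Definition ball_card (x : V) (s : nat) : nat := #|` fset_set [set y | walk s x y]|.

End Walks.

Section Graph.
Context d (V : measurableType d) (adj : rel V) (c : V -> baire).
Hypothesis adj_sym : symmetric adj.
Hypothesis adj_meas : measurable [set p : V * V | adj p.1 p.2].
Hypothesis hfin : locally_finite adj.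
Hypothesis hc : borel_embedding c.
Variable K : nat.
Hypothesis adj_bound : forall x (y : 'I_K.+1 -> V), (forall i, adj x (y i)) ->
    exists i j, i <> j /\ y i = y j.

Local Notation walk := (walk adj).
Local Notation ball_card := (ball_card adj).

Lemma measurable_adj_image (E : set V) : measurable E ->
  measurable [set x | exists y, adj x y /\ E y].
Proof.
move=> mE; apply: (measurable_proj (P := [set p | adj p.1 p.2 /\ E p.2]) (K := K) hc).
  by apply: mprop_and => //; exact: (mprop_preim measurable_snd).
by move=> x y h; apply: (adj_bound (x := x)) => i; have [] := h i.
Qed.

(** Countably many Borel functions enumerate the neighbours of every vertex: the
    function of index [s] maps [x] to its only neighbour whose code extends [s],
    and to itself if there is not exactly one such neighbour. *)
Lemma borel_neighbours : exists phi : nat -> V -> V,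
  (forall n, measurable_fun setT (phi n)) /\
  (forall x y, (x = y \/ adj x y) <-> exists n, phi n x = y).
Proof.
have [ic mc _] := hc.
pose code s : set V := [set x | forall i, i < size s -> c x i = nth 0 s i].
have mci i (P : nat -> Prop) : measurable [set x | P (c x i)].
  exact: (mprop_preim (P := [set a : baire | P (a i)]) mc (mprop_coord i P)).
have mcode s : measurable (code s).
  apply: mprop_forall => i; apply: mprop_imply; first exact: mprop_const.
  exact: (mci i (fun k => k = nth 0 s i)).
(* [D s] is the set of vertices with exactly one neighbour whose code extends
   [s]. *)
pose D s : set V := [set x | (exists y, adj x y /\ code s y) /\
  ~ exists i j, (exists y, adj x y /\ (code s y /\ c y i = j)) /\
                (exists y, adj x y /\ (code s y /\ c y i <> j))].
have mD s : measurable (D s).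
  apply: mprop_and; first exact: measurable_adj_image.
  apply: mprop_not; apply: mprop_exists => i; apply: mprop_exists => j.
  apply: mprop_and; apply: measurable_adj_image.
    by apply: mprop_and; [exact: mcode|exact: (mci i (fun k => k = j))].
  by apply: mprop_and; [exact: mcode|exact: (mci i (fun k => k <> j))].
have DP s x y y' : D s x -> adj x y -> code s y -> adj x y' -> code s y' -> y = y'.
  move=> [_ nD] xy sy xy' sy'; apply: ic; apply/funext => i; apply: contrapT => h.
  by apply: nD; exists i, (c y' i); split; [exists y'|exists y].
have /choice[f hf] : forall sx : seq nat * V, exists y,
    (D sx.1 sx.2 -> adj sx.2 y /\ code sx.1 y) /\ (~ D sx.1 sx.2 -> y = sx.2).
  move=> [s x]; have [Dx|nD] := pselect (D s x); last by exists x.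
  by have [[y xy] _] := Dx; exists y.
have mf s : measurable_fun setT (fun x => f (s, x)).
  move=> _ B mB; rewrite setTI.
  rewrite (_ : _ @^-1` _ = [set x | (D s x /\ exists y, adj x y /\ (code s y /\ B y)) \/
      (~ D s x /\ B x)]).
    apply: mprop_or; apply: mprop_and.
    - exact: mD.
    - by apply: measurable_adj_image; apply: mprop_and; [exact: mcode|exact: mB].
    - by apply: mprop_not; exact: mD.
    - exact: mB.
  apply/seteqP; split=> x /=.
    have [h1 h2] := hf (s, x); have [Dx|nD] := pselect (D s x).
      by move=> Bf; left; split=> //; exists (f (s, x)); have [] := h1 Dx.
    by rewrite h2 //; right.
  have [h1 h2] := hf (s, x); move=> [[Dx [y [xy [sy By]]]]|[nD Bx]].
    have [xf sf] := h1 Dx.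
    by rewrite (DP s x (f (s, x)) y Dx xf sf xy sy).
  by rewrite h2.
exists (fun n x => if unpickle n is Some (Some s) then f (s, x) else x); split.
  by move=> n; case: (unpickle n) => [[s|]|] //; exact: measurable_id.
move=> x y; split=> [[<-|xy]|[n <-]].
- by exists (pickle (None : option (seq nat))); rewrite pickleK.
- have [n hn] := separating_length ic (hfin x).
  exists (pickle (Some (mkseq (c y) n))); rewrite pickleK.
  have codeE z : code (mkseq (c y) n) z <-> agree n (c z) (c y).
    split=> h i; have := h i; rewrite size_mkseq => + lin => /(_ lin);
      by rewrite nth_mkseq.
  have Dx : D (mkseq (c y) n) x.
    split; first by exists y; split=> //; apply/codeE.
    move=> [i [j [[z [xz [sz zi]]] [z' [xz' [sz' zi']]]]]]; apply: zi'.
    have zy := hn z y xz xy ((codeE z).1 sz).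
    by rewrite (hn z' y xz' xy ((codeE z').1 sz')) -zy.
  have [h1 _] := hf (mkseq (c y) n, x); have [xf sf] := h1 Dx.
  by apply: (hn _ _ xf xy); apply/codeE.
- case: (unpickle n) => [[s|]|]; [|by left|by left].
  have [h1 h2] := hf (s, x); have [Dx|nD] := pselect (D s x).
    by right; have [] := h1 Dx.
  by left; rewrite h2.
Qed.

Lemma walk_enumerated : exists psi, enumerated_balls walk psi.
Proof.
have [phi [mphi phiP]] := borel_neighbours.
have /choice[psi hpsi] : forall s, exists f : nat -> V -> V,
    (forall n, measurable_fun setT (f n)) /\
    (forall x y, walk s x y <-> exists n, f n x = y).
  elim=> [|s [f [mf fP]]].
    exists (fun _ x => x); split=> [n|x y]; first exact: measurable_id.
    by rewrite walk0; split=> [->|[]//]; exists 0.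
  exists (fun k x => if unpickle k is Some (n, p) then phi p (f n x) else x); split.
    move=> k; case: (unpickle k) => [[n p]|]; last exact: measurable_id.
    exact: measurableT_comp.
  move=> x y; split=> [/walkS[z [/fP[n <-] /phiP[p <-]]]|[k <-]].
    by exists (pickle (n, p)); rewrite pickleK.
  case: (unpickle k) => [[n p]|]; last by exists [::].
  apply/walkS; exists (f n x); split; first by apply/fP; exists n.
  by apply/phiP; exists p.
exists psi; split.
- exact: walk0.
- by move=> s x y; exact: walk_sym.
- exact: walk_trans.
- exact: walk_leq.
- by move=> s x; exact: walk_fin.
- by move=> s; have [] := hpsi s.
- by move=> s; have [] := hpsi s.
Qed.

(** The carving is applied [n + 1] times, each time to what the preceding
    cells do not cover: after the last time, every ball of radius [0] contains
    less than one point. *)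
Lemma borel_covers (n r m q g : nat) :
  (forall x, ball_card x (m * r) <= g) -> q ^ m * g < q.+1 ^ m ->
  (forall x, ball_card x (n.+1 * (m * r + m * r)) < q ^ n.+1) ->
  exists U : 'I_n.+1 -> set (set V), (forall i, [/\ borel_family (U i),
      forall C a b, U i C -> C a -> C b -> walk (m * r + m * r) a b &
      forall C C' a b, U i C -> U i C' -> C a -> C' b -> walk r a b -> C = C']) /\
    (forall x, exists i C, U i C /\ C x).
Proof.
move=> hg qmg hq; have [psi hN] := walk_enumerated.
have [W [mW cW sW]] := separated_cover (m * r + m * r + r) hN hc.
have volT x s : vol walk setT x s = ball_card x s.
  by congr (#|` fset_set _|); apply/seteqP; split=> y /= => [[]|].
have hv x : vol walk setT x (m * r) <= g by rewrite volT.
pose A i := iter i (uncovered walk r m q W) setT.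
have mA i : measurable (A i).
  elim: i => [|i IH]; first exact: measurableT.
  exact: (measurable_uncovered hN hc).
have volA i y s : q ^ i * vol walk (A i) y s <=
    vol walk setT y (s + i * (m * r + m * r)).
  elim: i s => [|i IH] s; first by rewrite mul1n addn0.
  apply: (@leq_trans (q ^ i * vol walk (A i) y (s + (m * r + m * r)))).
    rewrite expnSr -mulnA leq_mul2l; apply/orP; right.
    exact: (vol_uncovered hN cW sW hv qmg).
  by rewrite mulSn [X in _ <= vol _ _ _ X]addnA; exact: IH.
have AN x : ~ A n.+1 x.
  move=> Ax; have := leq_ltn_trans (volA n.+1 x 0) _.
  rewrite volT add0n => /(_ _ (hq x)); apply/negP; rewrite -leqNgt.
  rewrite -[X in X <= _]muln1 leq_mul2l; apply/orP; right.
  rewrite cardfs_gt0; apply/fset0Pn; exists x; apply/(mem_vol hN); split=> //.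
  exact/walk0.
exists (fun i : 'I_n.+1 => cells walk r m q W (A i)); split=> [i|x].
  split.
  - exact: (cells_borel hN hc mW hv qmg).
  - exact: (cells_near hN).
  - exact: (cells_sep hN sW).
have ex : exists i, `[< ~ A i.+1 x >] by exists n; apply/asboolP.
case: (ex_minnP ex) => i /asboolP nAi mi.
have iN : i < n.+1 by rewrite ltnS mi//; apply/asboolP.
have Ax : A i x.
  case: i {iN} nAi mi => // i nAi mi; apply: contrapT => h.
  by have /mi := asboolT h; rewrite ltnn.
exists (Ordinal iN) => /=; apply: contrapT => h; apply: nAi; split=> //.
move=> [k [y [Wy Ry xC]]]; apply: h.
exists (cell walk r m q (remains walk r m q W (A i) k) y).
by split=> //; exists k, y.
Qed.

End Graph.

(** * Choice of the parameters *)

Lemma exp2_gt_pow M p0 : exists2 p, p0 <= p & p ^ M < 2 ^ p.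
Proof.
pose t := 2 * M + p0; exists (2 ^ (2 * t)).
  apply: leq_trans (ltnW (ltn_expl (2 * t) (ltnSn 1))).
  by rewrite /t; lia.
rewrite -expnM ltn_exp2l// mul2n -addnn expnD.
have tt : t < 2 ^ t by exact: ltn_expl.
apply: leq_ltn_trans (ltn_mul tt tt).
by rewrite /t; nia.
Qed.

Lemma bernoulli_exp q n : q ^ n.+1 + n.+1 * q ^ n <= q.+1 ^ n.+1.
Proof.
elim: n => [|n IH]; first by rewrite !expn1 expn0; lia.
rewrite (expnS q.+1); apply: leq_trans (leq_mul (leqnn q.+1) IH).
by rewrite (expnS q n.+1) (expnS q n); nia.
Qed.

Lemma double_exp_le q : 0 < q -> 2 * q ^ q <= q.+1 ^ q.
Proof.
by case: q => // q _; apply: leq_trans (bernoulli_exp _ _); rewrite mul2n -addnn -expnS.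
Qed.

(** If the volume [v] of the balls of radius [s] satisfies [v ^ b <= (s + 1) ^ a]
    with [a / b < N], then the carving can be done with [q] a power [p ^ k] of a
    large number [p], and [m = q * p]: the radii are less than [q ^ (1 + 2 / k)],
    and [(1 + 1/q) ^ m >= 2 ^ p]. *)
Lemma carving_parameters a b N r T : a < b * N -> 0 < r ->
  exists m q g, [/\ T <= m, q ^ m * g < q.+1 ^ m,
    forall v, v ^ b <= (m * r).+1 ^ a -> v <= g &
    forall v, v ^ b <= (N * (m * r + m * r)).+1 ^ a -> v < q ^ N].
Proof.
move=> abN r0; have b0 : 0 < b by case: b abN.
have N0 : 0 < N by case: N abN; rewrite ?muln0.
pose k := 2 * a + 1; pose M := (k + 2) * a.
have [p p0 pM] := exp2_gt_pow M (T + 2 * N * r + 2).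
pose q := p ^ k; pose m := q * p.
have p1 : 1 < p by lia.
have q0 : 0 < q by rewrite expn_gt0; lia.
have rad : (N * (m * r + m * r)).+1 <= p ^ (k + 2).
  rewrite expnD -/q (_ : q * p ^ 2 = m * p); last by rewrite /m; lia.
  have m0 : 0 < m by rewrite muln_gt0 q0; lia.
  apply: leq_trans (_ : m * (2 * N * r + 1) <= _); last first.
    by rewrite leq_mul2l; apply/orP; right; lia.
  by nia.
have radM : (N * (m * r + m * r)).+1 ^ a <= p ^ M.
  by rewrite /M expnM; case: (a) => [|a']; rewrite ?expn0// leq_exp2r.
exists m, q, (p ^ M); split.
- by rewrite /m; nia.
- rewrite /m mulnC !expnM.
  have := leq_exp2r (2 * q ^ q) (q.+1 ^ q) (_ : 0 < p).
  rewrite double_exp_le// => /(_ (ltnW p1)).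
  rewrite expnMn; apply: leq_trans.
  have h : 0 < (q ^ q) ^ p by rewrite expn_gt0 expn_gt0 q0.
  by rewrite (ltn_pmul2r h) -expnM.
- move=> v hv; have [->|v0] := posnP v; first by [].
  apply: leq_trans (_ : v ^ b <= _); first by rewrite -{1}(expn1 v) leq_pexp2l.
  apply: (leq_trans hv); apply: leq_trans radM.
  case: (a) => [|a']; rewrite ?expn0// leq_exp2r// ltnS.
  by nia.
- move=> v hv; rewrite -(ltn_exp2r _ _ b0).
  apply: (leq_ltn_trans hv); apply: (leq_ltn_trans radM).
  rewrite /q -!expnM ltn_exp2l// /M /k; nia.
Qed.

(** * Distances, diameters and growth *)

Section Growth.
Context (R : realType) (V : choiceType) (adj : rel V).
Local Open Scope ereal_scope.

Lemma gdist_le_walk s x y : gdist R adj x y <= s%:R%:E <-> walk adj s x y.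
Proof.
split=> [h|[p [pp py ps]]]; last first.
  apply: (@le_trans _ _ (size p)%:R%:E); last by rewrite lee_fin ler_nat.
  by apply: ereal_inf_lbound; exists p.
have /ereal_inf_lt[_ [p [pp py] <-]] : gdist R adj x y < s.+1%:R%:E.
  by apply: (le_lt_trans h); rewrite lte_fin ltr_nat.
by rewrite lte_fin ltr_nat ltnS => ps; exists p.
Qed.

Lemma growth_rate_ge0 (x0 : V) : 0 <= growth_rate R adj.
Proof.
apply: le_ereal_inf_tmp => _ [W [M [Mr MW]] <-].
pose t : R := (Num.max M 0 + 1)%R.
have Mt : (M < t)%R by rewrite ltr_pwDr// le_max lexx.
have t0 : (0 < t)%R by rewrite ltr_pwDr// le_max lexx orbT.
apply: (@le_trans _ _ (lne (growth adj t) / (ln (t + 1))%:E)); last first.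
  by apply: ereal_sup_ubound; exists t => //; exact: MW.
apply: mule_ge0; last first.
  rewrite inver; case: ifP => // _.
  by rewrite lee_fin invr_ge0 ln_ge0// lerDr ltW.
rewrite lne_ge0; apply: (@le_trans _ _ (counting (gball adj x0 t))); last first.
  by apply: ereal_sup_ubound; exists x0.
rewrite /counting; case: ifPn => [/asboolP fb|]; last by rewrite leey.
rewrite lee_fin ler1n cardfs_gt0; apply/fset0Pn; exists x0.
rewrite in_fset_set// inE /gball /=.
apply: (@le_trans _ _ 0%:R%:E); last by rewrite lee_fin ltW.
by apply/gdist_le_walk/walk0.
Qed.

End Growth.

Section GrowthBound.
Context (R : realType) d (V : measurableType d) (adj : rel V).
Hypothesis hfin : locally_finite adj.
Local Open Scope ereal_scope.

(** If the growth rate is less than [N], the balls of large radius [s] have at most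
    [(s + 1) ^ (a / b)] points, for some fraction [a / b] less than [N]. *)
Lemma growth_rate_lt (N : nat) : (0 < N)%N -> growth_rate R adj < N%:R%:E ->
  exists a b T, (a < b * N)%N /\ forall s x, (T <= s)%N ->
    (ball_card adj x s ^ b <= s.+1 ^ a)%N.
Proof.
move=> N0 /ereal_inf_lt[_ [W [M [_ MW]] <-] WN].
have [rho [rho0 rhoN hrho]] : exists rho : R, [/\ (0 <= rho)%R, (rho < N%:R)%R &
    forall t : R, (M < t)%R -> lne (growth adj t) / (ln (t + 1))%:E <= rho%:E].
  move: WN; case E : (ereal_sup _) => [y| |] // yN.
    exists (Num.max y 0)%R; split.
    - by rewrite le_max lexx orbT.
    - by rewrite gt_max -lte_fin yN ltr0n.
    - move=> t Mt; apply: (@le_trans _ _ y%:E); last by rewrite lee_fin le_max lexx.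
      by rewrite -E; apply: ereal_sup_ubound; exists t => //; exact: MW.
  exists 0%R; split; rewrite ?ltr0n// => t Mt.
  apply: (@le_trans _ _ -oo); last exact: leNye.
  by rewrite -E; apply: ereal_sup_ubound; exists t => //; exact: MW.
(* [b] is large enough for a fraction [a / b] to fit between [rho] and [N]. *)
pose b := (Num.truncn (N%:R - rho)^-1).+1.
pose a := (Num.truncn (rho * b%:R)).+1.
have Nr : (0 < N%:R - rho)%R by rewrite subr_gt0.
have rb0 : (0 <= rho * b%:R)%R by rewrite mulr_ge0.
have rba : (rho * b%:R < a%:R)%R by exact: truncnS_gt.
exists a, b, (Num.truncn M).+2; split.
  rewrite -(ltr_nat R) natrM.
  have h1 : (a%:R <= rho * b%:R + 1 :> R)%R.
    by rewrite /a -natr1 lerD2r truncn_le.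
  apply: (le_lt_trans h1).
  have : (1 < (N%:R - rho) * b%:R)%R.
    by rewrite -ltr_pdivrMl// mulr1; exact: truncnS_gt.
  by rewrite mulrBl ltrBrDl [X in _ -> (_ < X)%R]mulrC.
move=> s x Ms.
have Mt : (M < s%:R)%R.
  apply: lt_le_trans (truncnS_gt M) _; rewrite ler_nat; exact: ltnW.
have s0 : (0 < s)%N by case: s Ms {Mt}.
have L0 : (0 < ln (s%:R + 1) :> R)%R by rewrite ln_gt0// ltrDr ltr0n.
have v0 : (0 < ball_card adj x s)%N.
  rewrite cardfs_gt0; apply/fset0Pn; exists x.
  rewrite in_fset_set; last exact: walk_fin.
  by rewrite inE; apply: (walk_leq (leq0n s)); apply/walk0.
have vG : (ball_card adj x s)%:R%:E <= growth adj (s%:R : R).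
  apply: ereal_sup_ubound; exists x => //.
  rewrite (_ : gball _ _ _ = [set y | walk adj s x y]).
    by rewrite /counting asboolT//; exact: walk_fin.
  by apply/seteqP; split=> y; rewrite /gball /= => /gdist_le_walk.
have := hrho _ Mt; rewrite inver (gt_eqF L0).
case: (growth adj _) vG => [G| |]; last by rewrite leeNy_eq.
  rewrite lee_fin => vG.
  have G0 : (0 < G)%R by apply: lt_le_trans vG; rewrite ltr0n.
  rewrite lne_EFin// -EFinM lee_fin ler_pdivrMr// => hG.
  rewrite -(ler_nat R) !natrX -ler_ln ?posrE ?exprn_gt0 ?ltr0n//.
  rewrite !lnXn ?ltr0n// -[leLHS]mulr_natr -[leRHS]mulr_natr.
  apply: (@le_trans _ _ (rho * ln (s%:R + 1) * b%:R)%R).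
    rewrite ler_wpM2r//; apply: le_trans hG.
    by rewrite ler_ln ?posrE ?ltr0n.
  rewrite -natr1 mulrAC mulrC ler_wpM2l// ltW//.
by move=> _ /=; rewrite gt0_mulye ?lte_fin ?invr_gt0.
Qed.

End GrowthBound.

(** Degrees are bounded if the volumes of the balls of some positive radius are. *)
Lemma adj_bound_of_ball_card d (V : measurableType d) (adj : rel V) s K :
  locally_finite adj -> 0 < s -> (forall x, ball_card adj x s <= K) ->
  forall x (y : 'I_K.+1 -> V), (forall i, adj x (y i)) ->
    exists i j, i <> j /\ y i = y j.
Proof.
move=> hfin s0 hK x y xy; apply: contrapT => h.
have iy : injective y.
  by move=> i j yij; apply: contrapT => ij; apply: h; exists i, j.
have := hK x; rewrite leqNgt => /negP; apply.
rewrite -[K.+1]card_ord -(size_codom y); apply: uniq_leq_size.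
  by rewrite map_inj_uniq// enum_uniq.
move=> _ /codomP[i ->]; rewrite in_fset_set; last exact: walk_fin.
by rewrite inE; exists [:: y i]; rewrite /= xy.
Qed.

Local Open Scope ereal_scope.

Theorem theorem1p25 (R : realType) (d : measure_display) (V : measurableType d)
    (adj : rel V) (hG : borel_graph R adj) (hfin : locally_finite adj) :
  asdim_borel R adj <= growth_rate R adj.
Proof.
have [sbV adj_sym _ adj_meas] := hG.
have [c hc] := standard_borel_embedding sbV.
have := growth_rate_ge0 R adj point.
case E : (growth_rate R adj) => [v| |]; [|by move=> _; rewrite leey|by []].
rewrite lee_fin => v0; pose n := Num.truncn v.
apply: (@le_trans _ _ n%:R%:E); last by rewrite lee_fin truncn_le.
apply: ereal_inf_lbound; exists n => // rho rho0.
have [|a [b [T [abN hT]]]] := @growth_rate_lt R _ _ adj hfin n.+1 isT.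
  by rewrite E lte_fin; exact: truncnS_gt.
have b0 : (0 < b)%N by case: b abN {hT}.
pose r := (Num.truncn rho).+1.
have [m [q [g [Tm qmg hg hq]]]] := carving_parameters T abN (ltn0Sn _ : (0 < r)%N).
have Tr k : (m * r <= k)%N -> (T <= k)%N.
  by apply: leq_trans; rewrite (leq_trans Tm)// leq_pmulr.
have adj_bound : forall x (y : 'I_(T.+2 ^ a).+1 -> V), (forall i, adj x (y i)) ->
    exists i j, i <> j /\ y i = y j.
  apply: (adj_bound_of_ball_card (s := T.+1)) => // x.
  apply: leq_trans (hT T.+1 x (leqnSn T)).
  have [->|w0] := posnP (ball_card adj x T.+1); first by [].
  by rewrite -[X in (X <= _)%N]expn1 leq_pexp2l.
have small_ball x : (ball_card adj x (m * r) <= g)%N.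
  by apply: hg; apply: hT; exact: Tr.
have large_ball x : (ball_card adj x (n.+1 * (m * r + m * r)) < q ^ n.+1)%N.
  by apply: hq; apply: hT; apply: Tr; rewrite mulSn -addnA leq_addr.
have [U [hU cU]] :=
  borel_covers adj_sym adj_meas hfin hc adj_bound small_ball qmg large_ball.
exists U; split=> // i; have [bU nU sU] := hU i; split=> //.
- apply: (@le_lt_trans _ _ (m * r + m * r)%:R%:E); last exact: ltry.
  apply: ge_ereal_sup => _ [C UC <-]; apply: ge_ereal_sup => _ [x Cx [y Cy <-]].
  by apply/gdist_le_walk; exact: nU Cx Cy.
- move=> C C' UC UC' CC'.
  apply: (@lt_le_trans _ _ r%:R%:E); first by rewrite lte_fin; exact: truncnS_gt.
  apply: le_ereal_inf_tmp => _ [x Cx [y C'y <-]].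
  rewrite leNgt; apply/negP => /ltW/gdist_le_walk xy.
  exact: CC' (sU _ _ _ _ UC UC' Cx C'y xy).
Qed.
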